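(* Let $(G_{\mathbb Z},\mathfrak M_{\mathbb Z})$ be one of the following pairs (defined explicitly in the context): $$\bigl(SL_6(\mathbb Z),\ \wedge^3(\mathbb Z^6)\bigr),\qquad \bigl(D_6(\mathbb Z),\ \text{half-spin}_{\mathbb Z}\bigr),\qquad \bigl(E_7(\mathbb Z),\ V(\omega_7)_{\mathbb Z}\bigr).$$ Then: (1) The $G_{\mathbb Z}$-invariant quartic form $q'$ (the norm) on the module $\mathfrak M_{\mathbb Z}$ takes only values congruent to $0$ or $1$ modulo $4$. (2) Let $n$ be an integer with $n\equiv 0$ or $1 \pmod 4$. The group $G_{\mathbb Z}$ acts transitively on the set of projective elements of $\mathfrak M_{\mathbb Z}$ of norm $n$. (3) If $n$ is a fundamental discriminant (including the case $n=1$), then every element of $\mathfrak M_{\mathbb Z}$ of norm $n$ is projective, and hence $G_{\mathbb Z}$ acts transitively on the set of elements of norm $n$.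
   Context: Composition rings. $\mathbb H_{\mathbb Z}=M_2(\mathbb Z)$ with norm $\mathbf n=\det$, trace $\mathbf t$ the matrix trace, and conjugation $\overline{\begin{pmatrix}a&b\\c&d\end{pmatrix}}=\begin{pmatrix}d&-b\\-c&a\end{pmatrix}$; $\mathbb B_{\mathbb Z}\subset\mathbb H_{\mathbb Z}$ is the subring of diagonal matrices; $\mathbb O_{\mathbb Z}=\mathbb H_{\mathbb Z}\oplus\mathbb H_{\mathbb Z}v$ with product $(a+bv)(c+dv)=(ac-\bar d b)+(da+b\bar c)v$, norm $\mathbf n(a+bv)=\det a+\det b$, conjugation $\overline{a+bv}=\bar a-bv$. Put $\mathbf n(u,w)=\mathbf n(u+w)-\mathbf n(u)-\mathbf n(w)$. Cubic modules. For $C_{\mathbb Z}\in\{\mathbb B_{\mathbb Z},\mathbb H_{\mathbb Z},\mathbb O_{\mathbb Z}\}$, $\mathfrak J_{\mathbb Z}=\mathcal H_3(C_{\mathbb Z})$ is the $\mathbb Z$-module of Hermitian matrices $A=\begin{pmatrix}a&z&\bar y\\ \bar z&b&x\\ y&\bar x&c\end{pmatrix}$, $a,b,c\in\mathbb Z$, $x,y,z\in C_{\mathbb Z}$, with cubic norm $N(A)=abc-a\,x\bar x-b\,y\bar y-c\,z\bar z+(xy)z+\bar z(\bar y\bar x)$ and trace bilinear form $(A,A')=aa'+bb'+cc'+\mathbf n(x,x')+\mathbf n(y,y')+\mathbf n(z,z')$. The element with $x=y=z=0$ is written $\mathrm{diag}\{a,b,c\}$. The sharp map is defined by $(A^\#,B)=3N(A,A,B)$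 for all $B$, where $N(\cdot,\cdot,\cdot)$ is the symmetric trilinear form (over $\mathbb Q$) with $N(A,A,A)=N(A)$; it maps $\mathfrak J_{\mathbb Z}$ to itself. Freudenthal modules. $\mathfrak M(\mathfrak J_{\mathbb Z})=\mathbb Z\oplus\mathbb Z\oplus\mathfrak J_{\mathbb Z}\oplus\mathfrak J_{\mathbb Z}$, with elements written $(\alpha,\beta,A,B)$, carries the skew form $\{(\alpha,\beta,A,B),(\gamma,\delta,C,D)\}=\alpha\delta-\beta\gamma+(A,D)-(B,C)$ and the quartic form (the norm) $$q'(\alpha,\beta,A,B)=-4(A^\#,B^\#)+4\alpha N(A)+4\beta N(B)+\bigl((A,B)-\alpha\beta\bigr)^2 .$$ $\mathrm{Inv}(\mathfrak M(\mathfrak J_{\mathbb Z}))$ is the group of invertible $\mathbb Z$-linear transformations of $\mathfrak M(\mathfrak J_{\mathbb Z})$ preserving both $q'$ and $\{\cdot,\cdot\}$. The three pairs. $(D_6(\mathbb Z),\text{half-spin}_{\mathbb Z})$ and $(E_7(\mathbb Z),V(\omega_7)_{\mathbb Z})$ denote $(\mathrm{Inv}(\mathfrak M(\mathfrak J_{\mathbb Z})),\mathfrak M(\mathfrak J_{\mathbb Z}))$ for $\mathfrak J_{\mathbb Z}=\mathcal H_3(\mathbb H_{\mathbb Z})$ (rank $32$) and $\mathfrak J_{\mathbb Z}=\mathcal H_3(\mathbb O_{\mathbb Z})$ (rank $56$), respectively. For $SL_6(\mathbb Z)$ acting naturally on $\wedge^3(\mathbb Z^6)$, use $\mathfrak J_{\mathbb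 Z}=\mathcal H_3(\mathbb B_{\mathbb Z})$: identify $\mathcal H_3(\mathbb B_{\mathbb Z})$ with $M_3(\mathbb Z)$ by sending a Hermitian matrix with diagonal $a_{11},a_{22},a_{33}$ and above-diagonal entries $\begin{pmatrix}a_{ij}&0\\0&a_{ji}\end{pmatrix}$ ($i<j$) to $(a_{ij})$ (then $N=\det$, $(A,B)=\mathrm{tr}(AB)$, and $\#$ is the classical adjoint), and identify $\mathfrak M(M_3(\mathbb Z))$ with $\wedge^3(\mathbb Z^6)$ by the $\mathbb Z$-linear isomorphism $(1,0,0,0)\mapsto e_1\wedge e_2\wedge e_3$, $(0,1,0,0)\mapsto f_1\wedge f_2\wedge f_3$, $(0,0,E_{ij},0)\mapsto e_i\wedge f_j^*$, $(0,0,0,E_{ij})\mapsto f_i\wedge e_j^*$, where $e_1,e_2,e_3,f_1,f_2,f_3$ is the standard basis of $\mathbb Z^6$, $e_1^*=e_2\wedge e_3$, $e_2^*=e_3\wedge e_1$, $e_3^*=e_1\wedge e_2$, and similarly for $f_i^*$. The norm and the notion of projective element on $\wedge^3(\mathbb Z^6)$ are transported by this isomorphism. Projective elements. An element $(\alpha,\beta,A,0)$ of $\mathfrak M(\mathfrak J_{\mathbb Z})$ is diagonal reduced if $\alpha>0$, $A=\mathrm{diag}\{a_1,a_2,a_3\}$, $\alpha\mid\beta$ and $\alpha\mid a_i$ for all $i$. Such an element is projective if $\gcd(\alpha a_1,\alpha\beta,a_2a_3)=\gcd(\alpha a_2,\alpha\beta,a_1a_3)=\gcd(\alpha a_3,\alpha\beta,a_1a_2)=1$.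 An arbitrary $x\in\mathfrak M(\mathfrak J_{\mathbb Z})$ is projective if its $\mathrm{Inv}(\mathfrak M(\mathfrak J_{\mathbb Z}))$-orbit contains a diagonal reduced element that is projective. An integer $n$ is a fundamental discriminant if $n$ is squarefree and $n\equiv1\pmod 4$, or $n=4k$ with $k$ squarefree and $k\equiv2$ or $3\pmod 4$. *)

(* Defs.v *)
From HB Require Import structures.
From mathcomp Require Import all_boot all_order all_algebra.
From mathcomp Require Import ring zify.

Set Implicit Arguments.
Unset Strict Implicit.
Unset Printing Implicit Defensive.

Import Order.TTheory GRing.Theory Num.Theory.
Local Open Scope ring_scope.

(* A possibly non-associative ring over Z with involution, norm and trace. The
   multiplication is not part of an algebraic structure of the library because
   of the octonions. [cr_scal] reads off k from the scalar element 1 *~ k; its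
   values on other elements are irrelevant. The laws are those needed to show
   that the cubic norm is an integer and that the sharp map exists and is
   unique. *)
Record comp_ring := CompRing {
  cr_sort :> zmodType;
  cr_one : cr_sort;
  cr_mul : cr_sort -> cr_sort -> cr_sort;
  cr_conj : cr_sort -> cr_sort;
  cr_norm : cr_sort -> int;
  cr_trace : cr_sort -> int;
  cr_scal : cr_sort -> int;
  cr_scal1 : forall k : int, cr_scal (cr_one *~ k) = k;
  cr_mulDl : forall x y z, cr_mul (x + y) z = cr_mul x z + cr_mul y z;
  cr_mulDr : forall x y z, cr_mul x (y + z) = cr_mul x y + cr_mul x z;
  cr_conjD : forall x y, cr_conj (x + y) = cr_conj x + cr_conj y;
  cr_conjK : forall x, cr_conj (cr_conj x) = x;
  cr_conjM : forall x y, cr_conj (cr_mul x y) = cr_mul (cr_conj y) (cr_conj x);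
  cr_mul_conj : forall x, cr_mul x (cr_conj x) = cr_one *~ cr_norm x;
  cr_add_conj : forall x, x + cr_conj x = cr_one *~ cr_trace x;
  cr_traceC : forall x y, cr_trace (cr_mul x y) = cr_trace (cr_mul y x);
  cr_traceA : forall x y z,
    cr_trace (cr_mul (cr_mul x y) z) = cr_trace (cr_mul x (cr_mul y z));
  cr_nondeg : forall x,
    (forall y, cr_norm (x + y) - cr_norm x - cr_norm y = 0) -> x = 0
}.

Declare Scope comp_scope.
Delimit Scope comp_scope with C.
Local Open Scope comp_scope.
Notation "x ∘ y" := (cr_mul x y) (at level 40, left associativity) : comp_scope.
Notation "x ^†" := (cr_conj x) (at level 2, format "x ^†") : comp_scope.

Definition norm2 (C : comp_ring) (x y : C) : int :=
  cr_norm (x + y) - cr_norm x - cr_norm y.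

Lemma additive_mulrz (U V : zmodType) (f : U -> V) :
  {morph f : x y / x + y} -> forall x (k : int), f (x *~ k) = f x *~ k.
Proof.
move=> fD.
have f0 : f 0 = 0 by apply: (addrI (f 0)); rewrite -fD !addr0.
have fN x : f (- x) = - f x by apply: (addrI (f x)); rewrite -fD !subrr.
have fn x n : f (x *+ n) = f x *+ n.
  by elim: n => [|n IH]; rewrite ?mulr0n // !mulrS fD IH.
by move=> x [n|n]; rewrite ?NegzE ?mulrNz ?fN -!pmulrn fn.
Qed.

Section CompRingTheory.
Variable C : comp_ring.
Implicit Types (x y z : C) (k : int).

Lemma cr_one_inj : injective (fun k => cr_one C *~ k).
Proof. by move=> k l /(congr1 (@cr_scal C)); rewrite !cr_scal1. Qed.

Lemma cr_traceD x y : cr_trace (x + y) = cr_trace x + cr_trace y.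
Proof.
by apply: cr_one_inj; rewrite mulrzDr -!cr_add_conj cr_conjD addrACA.
Qed.

Lemma norm2E x y : norm2 x y = cr_trace (x ∘ y^†).
Proof.
apply: cr_one_inj; rewrite -cr_add_conj cr_conjM cr_conjK !mulrzBr -!cr_mul_conj.
rewrite cr_conjD !cr_mulDl !cr_mulDr addrA -[RHS](addrK (y ∘ y^†)); congr (_ - _).
by rewrite -!addrA addrC !addrA subrK.
Qed.

Lemma norm2C x y : norm2 x y = norm2 y x.
Proof. by rewrite /norm2 (addrC x) addrAC. Qed.

Lemma norm2Dl x y z : norm2 (x + y) z = norm2 x z + norm2 y z.
Proof. by rewrite !norm2E cr_mulDl cr_traceD. Qed.

Lemma norm2Dr x y z : norm2 x (y + z) = norm2 x y + norm2 x z.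
Proof. by rewrite norm2C norm2Dl !(norm2C x). Qed.

Lemma cr_normD x y : cr_norm (x + y) = cr_norm x + cr_norm y + norm2 x y.
Proof. by rewrite /norm2; ring. Qed.

Lemma norm2zl x y k : norm2 (x *~ k) y = k * norm2 x y.
Proof.
rewrite (additive_mulrz (f := fun u => norm2 u y)) ?mulrzz 1?mulrC //.
by move=> u v /=; rewrite norm2Dl.
Qed.

Lemma norm2xx x : norm2 x x = 2 * cr_norm x.
Proof.
apply: (addIr (2 * cr_norm x)).
have -> : 2 * cr_norm x + 2 * cr_norm x = cr_norm (x + x).
  apply: cr_one_inj.
  rewrite -cr_mul_conj cr_conjD cr_mulDl !cr_mulDr !cr_mul_conj -!mulrzDr.
  by congr (_ *~ _); ring.
by rewrite cr_normD; ring.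
Qed.

Lemma norm2_conj x y : norm2 x y^† = cr_trace (x ∘ y).
Proof. by rewrite norm2E cr_conjK. Qed.

End CompRingTheory.

(* ((a, b, c), (x, y, z)) stands for the Hermitian matrix
     [ a   z   y^† ]
     [ z^† b   x   ]
     [ y   x^† c   ]. *)
Definition cubic (C : comp_ring) : Type :=
  ((int * int * int) * (C * C * C))%type.

HB.instance Definition _ (C : comp_ring) := GRing.Zmodule.on (cubic C).

Section CubicModule.
Variable C : comp_ring.
Implicit Types A B : cubic C.

Definition cubic_mx A : 'M[C]_3 :=
  let: ((a, b, c), (x, y, z)) := A in
  let s k := cr_one C *~ k in
  \matrix_(i, j) nth 0 (nth [::] [:: [:: s a;  z;    y^†];
                                     [:: z^†; s b;  x  ];
                                     [:: y;   x^†; s c ]] i) j.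

Definition cdiag (a b c : int) : cubic C := ((a, b, c), (0, 0, 0)).

(* The cubic norm as an element of C; [cubic_norm_scalar] shows that it lies
   in Z. *)
Definition cubic_norm_elt A : C :=
  let: ((a, b, c), (x, y, z)) := A in
  cr_one C *~ (a * b * c)
    - (x ∘ x^†) *~ a - (y ∘ y^†) *~ b - (z ∘ z^†) *~ c
    + (x ∘ y) ∘ z + z^† ∘ (y^† ∘ x^†).

Definition cubic_norm A : int := cr_scal (cubic_norm_elt A).

Definition cubic_trace A B : int :=
  let: ((a, b, c), (x, y, z)) := A in
  let: ((a', b', c'), (x', y', z')) := B in
  a * a' + b * b' + c * c' + norm2 x x' + norm2 y y' + norm2 z z'.

(* The symmetric trilinear form of the cubic form [cubic_norm], by
   polarization; see [cubic_tri_diag], [cubic_triD], [cubic_triC12] and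
   [cubic_triC23]. *)
Definition cubic_tri A B D : rat :=
  (cubic_norm (A + B + D) - cubic_norm (A + B) - cubic_norm (A + D)
   - cubic_norm (B + D) + cubic_norm A + cubic_norm B + cubic_norm D)%:~R / 6.

Lemma cubicDE a b c a' b' c' (x y z x' y' z' : C) :
  ((a, b, c), (x, y, z)) + ((a', b', c'), (x', y', z')) =
  ((a + a', b + b', c + c'), (x + x', y + y', z + z')) :> cubic C.
Proof. by []. Qed.

Lemma cubic_norm_elt_scalar a b c (x y z : C) :
  cubic_norm_elt ((a, b, c), (x, y, z)) =
  cr_one C *~ (a * b * c - a * cr_norm x - b * cr_norm y - c * cr_norm z
               + cr_trace ((x ∘ y) ∘ z)).
Proof.
rewrite /cubic_norm_elt -!cr_conjM -addrA cr_add_conj !cr_mul_conj -!mulrzA.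
by rewrite -!mulrzBr -mulrzDr; congr (_ *~ _); ring.
Qed.

Lemma cubic_normE a b c (x y z : C) :
  cubic_norm ((a, b, c), (x, y, z)) =
  a * b * c - a * cr_norm x - b * cr_norm y - c * cr_norm z
  + cr_trace ((x ∘ y) ∘ z).
Proof. by rewrite /cubic_norm cubic_norm_elt_scalar cr_scal1. Qed.

Lemma cubic_norm_scalar A : cubic_norm_elt A = cr_one C *~ cubic_norm A.
Proof.
case: A => [[[a b] c] [[x y] z]].
by rewrite cubic_normE cubic_norm_elt_scalar.
Qed.

Let T3 (x y z : C) := cr_trace ((x ∘ y) ∘ z).

(* Six times the trilinear form. *)
Let P6 A B D : int :=
  let: ((a1, b1, c1), (x1, y1, z1)) := A in
  let: ((a2, b2, c2), (x2, y2, z2)) := B in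
  let: ((a3, b3, c3), (x3, y3, z3)) := D in
  a1 * b2 * c3 + a1 * b3 * c2 + a2 * b1 * c3 + a2 * b3 * c1
    + a3 * b1 * c2 + a3 * b2 * c1
  - (a1 * norm2 x2 x3 + a2 * norm2 x1 x3 + a3 * norm2 x1 x2)
  - (b1 * norm2 y2 y3 + b2 * norm2 y1 y3 + b3 * norm2 y1 y2)
  - (c1 * norm2 z2 z3 + c2 * norm2 z1 z3 + c3 * norm2 z1 z2)
  + (T3 x1 y2 z3 + T3 x1 y3 z2 + T3 x2 y1 z3 + T3 x2 y3 z1
     + T3 x3 y1 z2 + T3 x3 y2 z1).

Let P6E A B D : cubic_tri A B D = (P6 A B D)%:~R / 6.
Proof.
rewrite /cubic_tri; congr (_%:~R / _).
case: A B D => [[[a1 b1] c1] [[x1 y1] z1]] [[[a2 b2] c2] [[x2 y2] z2]].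
move=> [[[a3 b3] c3] [[x3 y3] z3]].
rewrite !cubicDE !cubic_normE /P6 /T3.
rewrite !cr_normD !norm2Dl !(cr_mulDl, cr_mulDr, cr_traceD).
ring.
Qed.

Lemma cubic_tri_diag A : cubic_tri A A A = (cubic_norm A)%:~R.
Proof.
rewrite P6E (_ : P6 A A A = cubic_norm A * 6) ?intrM ?mulfK //.
case: A => [[[a b] c] [[x y] z]].
rewrite cubic_normE /P6 /T3 !norm2xx; ring.
Qed.

Lemma cubic_triC12 A B D : cubic_tri A B D = cubic_tri B A D.
Proof. by rewrite /cubic_tri (addrC A B); congr (_%:~R / _); ring. Qed.

Lemma cubic_triC23 A B D : cubic_tri A B D = cubic_tri A D B.
Proof.
by rewrite /cubic_tri (addrAC A B D) (addrC B D); congr (_%:~R / _); ring.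
Qed.

Lemma cubic_triD A A' B D :
  cubic_tri (A + A') B D = cubic_tri A B D + cubic_tri A' B D.
Proof.
rewrite !P6E -mulrDl -intrD; congr (_%:~R / _).
case: A A' => [[[a0 b0] c0] [[x0 y0] z0]] [[[a1 b1] c1] [[x1 y1] z1]].
case: B D => [[[a2 b2] c2] [[x2 y2] z2]] [[[a3 b3] c3] [[x3 y3] z3]].
rewrite !cubicDE /P6 /T3.
rewrite !norm2Dl !(cr_mulDl, cr_mulDr, cr_traceD).
ring.
Qed.

Let sharp_formula A : cubic C :=
  let: ((a, b, c), (x, y, z)) := A in
  ((b * c - cr_norm x, c * a - cr_norm y, a * b - cr_norm z),
   ((y ∘ z)^† - x *~ a, (z ∘ x)^† - y *~ b, (x ∘ y)^† - z *~ c)).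

Let sharp_formulaP A B :
  (cubic_trace (sharp_formula A) B)%:~R = 3 * cubic_tri A A B.
Proof.
rewrite P6E.
suff -> : P6 A A B = cubic_trace (sharp_formula A) B * 2.
  by rewrite intrM; field.
case: A B => [[[a b] c] [[x y] z]] [[[a' b'] c'] [[x' y'] z']].
rewrite /P6 /T3 /= -!mulrNz !norm2Dl !norm2zl !norm2xx.
rewrite !(norm2C (cr_conj _)) !norm2_conj.
rewrite [cr_trace (x' ∘ y ∘ z)]cr_traceA.
rewrite [cr_trace (x ∘ y' ∘ z)]cr_traceA [cr_trace (x ∘ (y' ∘ z))]cr_traceC.
rewrite [cr_trace (y' ∘ z ∘ x)]cr_traceA.
rewrite [cr_trace (x ∘ y ∘ z')]cr_traceC.
ring.
Qed.

Lemma sharp_exists A :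
  {S : cubic C | forall B, (cubic_trace S B)%:~R = 3 * cubic_tri A A B}.
Proof. by exists (sharp_formula A); apply: sharp_formulaP. Qed.

(* Uniquely determined by [sharpP] since the trace form is nondegenerate, see
   [cubic_trace_inj]; [sharpE] is the explicit formula. *)
Definition sharp A : cubic C := sval (sharp_exists A).

Lemma sharpP A B : (cubic_trace (sharp A) B)%:~R = 3 * cubic_tri A A B.
Proof. exact: (svalP (sharp_exists A)). Qed.

Lemma cubic_trace_inj S S' : cubic_trace S =1 cubic_trace S' -> S = S'.
Proof.
have n0 (x : C) : norm2 x 0 = 0.
  by apply: (addrI (norm2 x 0)); rewrite -norm2Dr !addr0.
have nI (x x' : C) : norm2 x =1 norm2 x' -> x = x'.
  move=> e; apply/eqP; rewrite -subr_eq0; apply/eqP/cr_nondeg => y.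
  by rewrite -/(norm2 _ y) norm2Dl e -[- x']mulrN1z norm2zl; ring.
case: S S' => [[[a b] c] [[x y] z]] [[[a' b'] c'] [[x' y'] z']] e.
have ea := e ((1, 0, 0), (0, 0, 0)); have eb := e ((0, 1, 0), (0, 0, 0)).
have ec := e ((0, 0, 1), (0, 0, 0)).
have ex u := e ((0, 0, 0), (u, 0, 0)); have ey u := e ((0, 0, 0), (0, u, 0)).
have ez u := e ((0, 0, 0), (0, 0, u)).
move: ea eb ec ex ey ez; rewrite /cubic_trace /= !n0 !(mulr0, mulr1, add0r, addr0).
move=> -> -> -> ex ey ez; congr (_, (_, _, _)); apply: nI => u.
- by move: (ex u); rewrite !(add0r, addr0).
- by move: (ey u); rewrite !(add0r, addr0).
- by move: (ez u); rewrite !(add0r, addr0).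
Qed.

Lemma sharpE a b c (x y z : C) :
  sharp ((a, b, c), (x, y, z)) =
  ((b * c - cr_norm x, c * a - cr_norm y, a * b - cr_norm z),
   ((y ∘ z)^† - x *~ a, (z ∘ x)^† - y *~ b, (x ∘ y)^† - z *~ c)).
Proof.
apply: cubic_trace_inj => B; apply: (@intr_inj rat).
by rewrite sharpP -sharp_formulaP.
Qed.

End CubicModule.

(* diag (x.1, x.2) is represented by the pair of its diagonal entries. *)
Definition bin_mx (x : int * int) : 'M[int]_2 :=
  \matrix_(i, j) nth 0 (nth [::] [:: [:: x.1; 0]; [:: 0; x.2]] i) j.
Definition bin_mul (x y : int * int) : int * int := (x.1 * y.1, x.2 * y.2).
Definition bin_conj (x : int * int) : int * int := (x.2, x.1).

Definition quat_conj (x : 'M[int]_2) : 'M[int]_2 :=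
  \matrix_(i, j)
    nth 0 (nth [::] [:: [:: x 1 1; - x 0 1]; [:: - x 1 0; x 0 0]] i) j.

(* (a, b) stands for a + b v. *)
Definition oct_mul (x y : 'M[int]_2 * 'M[int]_2) : 'M[int]_2 * 'M[int]_2 :=
  let: (a, b) := x in let: (c, d) := y in
  (a *m c - quat_conj d *m b, d *m a + b *m quat_conj c).
Definition oct_conj (x : 'M[int]_2 * 'M[int]_2) : 'M[int]_2 * 'M[int]_2 :=
  (quat_conj x.1, - x.2).
Definition oct_norm (x : 'M[int]_2 * 'M[int]_2) : int := \det x.1 + \det x.2.

Lemma mx2P (A B : 'M[int]_2) :
  A 0 0 = B 0 0 -> A 0 1 = B 0 1 -> A 1 0 = B 1 0 -> A 1 1 = B 1 1 -> A = B.
Proof.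
move=> e00 e01 e10 e11; apply/matrixP => i j.
have I2 (k : 'I_2) : k = 0 \/ k = 1.
  by case: k => [[|[|//]] p]; [left | right]; apply: val_inj.
by case: (I2 i) => ->; case: (I2 j) => ->.
Qed.

Lemma mx2_mulE (A B : 'M[int]_2) i j :
  (A *m B) i j = A i 0 * B 0 j + A i 1 * B 1 j.
Proof.
by rewrite mxE !big_ord_recl big_ord0 addr0; congr (_ + A i _ * B _ j);
   apply: val_inj.
Qed.

Lemma mx2_traceE (A : 'M[int]_2) : \tr A = A 0 0 + A 1 1.
Proof.
by rewrite /mxtrace !big_ord_recl big_ord0 addr0; congr (_ + A _ _);
   apply: val_inj.
Qed.

Lemma mx2_detE (A : 'M[int]_2) : \det A = A 0 0 * A 1 1 - A 0 1 * A 1 0.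
Proof.
rewrite (expand_det_row _ 0) !big_ord_recl big_ord0 addr0.
rewrite /cofactor !det_mx11 !mxE /= /bump /= expr0 expr1 mul1r mulN1r mulrN.
by congr (A _ _ * A _ _ - A _ _ * A _ _); apply: val_inj.
Qed.

Definition mx2E := (mx2_mulE, mx2_traceE, mx2_detE).

Lemma mx2_mulrz (A : 'M[int]_2) (k : int) i j : (A *~ k) i j = A i j * k.
Proof.
by rewrite (additive_mulrz (f := fun M : 'M_2 => M i j)) ?mulrzz // => M N;
   rewrite mxE.
Qed.

Lemma pair_mulrz (U V : zmodType) (x : U * V) (k : int) :
  x *~ k = (x.1 *~ k, x.2 *~ k).
Proof.
by rewrite [LHS]surjective_pairing; congr (_, _);
   rewrite -(additive_mulrz (U := (U * V)%type)).
Qed.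

Lemma bin_mx_inj : injective bin_mx.
Proof.
move=> [a b] [c d] /matrixP e.
by move: (e 0 0) (e 1 1); rewrite !mxE /= => -> ->.
Qed.

Lemma bin_mxP (A : 'M[int]_2) : is_diag_mx A <-> exists x, A = bin_mx x.
Proof.
split=> [/is_diag_mxP A0 | [x ->]].
  by exists (A 0 0, A 1 1); apply: mx2P; rewrite !mxE //=; apply: A0.
by apply/is_diag_mxP => -[[|[|//]] ?] [[|[|//]] ?] //; rewrite !mxE.
Qed.

Lemma bin_mxD x y : bin_mx (x + y) = bin_mx x + bin_mx y.
Proof. by apply: mx2P; rewrite !mxE //= addr0. Qed.

Lemma bin_mxM x y : bin_mx (bin_mul x y) = bin_mx x *m bin_mx y.
Proof. by apply: mx2P; rewrite mx2E !mxE /=; ring. Qed.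

Lemma bin_mx1 : bin_mx (1, 1) = 1%:M.
Proof. by apply: mx2P; rewrite !mxE. Qed.

Lemma bin_mx_conj x : bin_mx (bin_conj x) = quat_conj (bin_mx x).
Proof. by apply: mx2P; rewrite !mxE //= oppr0. Qed.

Lemma bin_mx_norm x : \det (bin_mx x) = x.1 * x.2.
Proof. by rewrite mx2E !mxE /=; ring. Qed.

Lemma bin_mx_trace x : \tr (bin_mx x) = x.1 + x.2.
Proof. by rewrite mx2E !mxE. Qed.

Definition bin_ring : comp_ring.
Proof.
refine (@CompRing (int * int)%type (1, 1) bin_mul bin_conj
  (fun x => x.1 * x.2) (fun x => x.1 + x.2) fst _ _ _ _ _ _ _ _ _ _ _).
- by move=> k; rewrite pair_mulrz /= mulrzz mul1r.
- by move=> x y z; rewrite /bin_mul /= !mulrDl.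
- by move=> x y z; rewrite /bin_mul /= !mulrDr.
- by [].
- by case.
- by move=> x y; rewrite /bin_conj /bin_mul /= mulrC [x.1 * _]mulrC.
- by move=> [a b]; rewrite pair_mulrz /bin_mul /= !mulrzz !mul1r [b * a]mulrC.
- move=> [a b]; rewrite pair_mulrz /= !mulrzz !mul1r -[RHS]/(a + b, a + b).
  by rewrite {2}[a + b]addrC.
- by move=> x y; rewrite /= mulrC [x.2 * _]mulrC.
- by move=> x y z; rewrite /= !mulrA.
- move=> [a b] e; move: (e (1, 0)) (e (0, 1)) => /= e1 e2.
  have -> : a = 0 by move: e2; rewrite /GRing.add /=; lia.
  by have -> : b = 0 by move: e1; rewrite /GRing.add /=; lia.
Defined.

Lemma quat_conjD x y : quat_conj (x + y) = quat_conj x + quat_conj y.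
Proof. by apply: mx2P; rewrite !mxE //= opprD. Qed.

Lemma quat_conjK x : quat_conj (quat_conj x) = x.
Proof. by apply: mx2P; rewrite !mxE //= opprK. Qed.

Lemma quat_conjM x y : quat_conj (x *m y) = quat_conj y *m quat_conj x.
Proof. by apply: mx2P; rewrite !(mx2E, mxE) /=; ring. Qed.

Definition quat_ring : comp_ring.
Proof.
refine (@CompRing 'M[int]_2 1%:M (@mulmx _ _ _ _) quat_conj
  (fun x => \det x) (fun x => \tr x) (fun x => x 0 0)
  _ _ _ quat_conjD quat_conjK quat_conjM _ _ _ _ _).
- by move=> k; rewrite mx2_mulrz mxE mul1r.
- by move=> x y z; rewrite mulmxDl.
- by move=> x y z; rewrite mulmxDr.
- by move=> x; apply: mx2P; rewrite !(mx2E, mx2_mulrz, mxE) /=; ring.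
- by move=> x; apply: mx2P; rewrite !(mx2E, mx2_mulrz, mxE) /=; ring.
- by move=> x y; apply: mxtrace_mulC.
- by move=> x y z; rewrite mulmxA.
- move=> x e; apply: mx2P; rewrite [RHS]mxE.
  + by move: (e (delta_mx 1 1)); rewrite !(mx2E, mxE) /=; lia.
  + by move: (e (delta_mx 1 0)); rewrite !(mx2E, mxE) /=; lia.
  + by move: (e (delta_mx 0 1)); rewrite !(mx2E, mxE) /=; lia.
  + by move: (e (delta_mx 0 0)); rewrite !(mx2E, mxE) /=; lia.
Defined.

Lemma oct_trace_mulA x y z :
  \tr (oct_mul (oct_mul x y) z).1 = \tr (oct_mul x (oct_mul y z)).1.
Proof.
case: x y z => [x1 x2] [y1 y2] [z1 z2] /=.
by rewrite !(mx2E, mxE) /= ?(mx2E, mxE) /=; ring.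
Qed.

Definition oct_ring : comp_ring.
Proof.
refine (@CompRing ('M[int]_2 * 'M[int]_2)%type (1%:M, 0) oct_mul oct_conj
  oct_norm (fun x => \tr x.1) (fun x => x.1 0 0)
  _ _ _ _ _ _ _ _ _ oct_trace_mulA _).
- by move=> k; rewrite pair_mulrz mx2_mulrz mxE mul1r.
- move=> [a b] [c d] [x y]; congr (_, _) => /=.
    by rewrite mulmxDl mulmxDr opprD addrACA.
  by rewrite mulmxDl mulmxDr addrACA.
- move=> [a b] [c d] [x y]; congr (_, _) => /=.
    by rewrite quat_conjD mulmxDl mulmxDr opprD addrACA.
  by rewrite quat_conjD mulmxDl mulmxDr addrACA.
- by move=> [a b] [c d]; congr (_, _) => /=; rewrite ?quat_conjD ?opprD.
- by move=> [a b]; rewrite /oct_conj /= quat_conjK opprK.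
- by move=> [a b] [c d]; congr (_, _); apply: mx2P;
     rewrite !(mx2E, mxE) /= ?(mx2E, mxE) /=; ring.
- by move=> [a b]; rewrite pair_mulrz; congr (_, _); apply: mx2P;
     rewrite /oct_norm !(mx2E, mx2_mulrz, mxE) /= ?(mx2E, mxE) /=; ring.
- by move=> [a b]; rewrite pair_mulrz; congr (_, _); apply: mx2P;
     rewrite !(mx2E, mx2_mulrz, mxE) /= ?(mx2E, mxE) /=; ring.
- by move=> [a b] [c d]; rewrite /= !(mx2E, mxE) /= ?(mx2E, mxE) /=; ring.
- move=> [a b] e; congr (_, _); apply: mx2P; rewrite [RHS]mxE.
  + by move: (e (delta_mx 1 1, 0)); rewrite /oct_norm !(mx2E, mxE) /=; lia.
  + by move: (e (delta_mx 1 0, 0)); rewrite /oct_norm !(mx2E, mxE) /=; lia.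
  + by move: (e (delta_mx 0 1, 0)); rewrite /oct_norm !(mx2E, mxE) /=; lia.
  + by move: (e (delta_mx 0 0, 0)); rewrite /oct_norm !(mx2E, mxE) /=; lia.
  + by move: (e (0, delta_mx 1 1)); rewrite /oct_norm !(mx2E, mxE) /=; lia.
  + by move: (e (0, delta_mx 1 0)); rewrite /oct_norm !(mx2E, mxE) /=; lia.
  + by move: (e (0, delta_mx 0 1)); rewrite /oct_norm !(mx2E, mxE) /=; lia.
  + by move: (e (0, delta_mx 0 0)); rewrite /oct_norm !(mx2E, mxE) /=; lia.
Defined.

(* (alpha, beta, A, B). *)
Definition freudenthal (C : comp_ring) : Type :=
  (int * int * cubic C * cubic C)%type.

HB.instance Definition _ (C : comp_ring) := GRing.Zmodule.on (freudenthal C).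

Section FreudenthalModule.
Variable C : comp_ring.
Implicit Types X Y : freudenthal C.

Definition skew_form X Y : int :=
  let: (alpha, beta, A, B) := X in
  let: (gamma, delta, C, D) := Y in
  alpha * delta - beta * gamma + cubic_trace A D - cubic_trace B C.

Definition quartic X : int :=
  let: (alpha, beta, A, B) := X in
  - 4 * cubic_trace (sharp A) (sharp B)
  + 4 * alpha * cubic_norm A + 4 * beta * cubic_norm B
  + (cubic_trace A B - alpha * beta) ^+ 2.

Definition Inv (g : freudenthal C -> freudenthal C) : Prop :=
  [/\ forall (k : int) X Y, g (X *~ k + Y) = g X *~ k + g Y,
      bijective g,
      forall X, quartic (g X) = quartic X
    & forall X Y, skew_form (g X) (g Y) = skew_form X Y].

Definition diag_elt (alpha beta a1 a2 a3 : int) : freudenthal C :=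
  (alpha, beta, cdiag C a1 a2 a3, 0).

Definition diagonal_reduced (alpha beta a1 a2 a3 : int) : Prop :=
  [/\ 0 < alpha, (alpha %| beta)%Z, (alpha %| a1)%Z, (alpha %| a2)%Z
    & (alpha %| a3)%Z].

Definition gcd3 (a b c : int) : int := gcdz (gcdz a b) c.

Definition diagonal_projective (alpha beta a1 a2 a3 : int) : Prop :=
  [/\ gcd3 (alpha * a1) (alpha * beta) (a2 * a3) = 1,
      gcd3 (alpha * a2) (alpha * beta) (a1 * a3) = 1
    & gcd3 (alpha * a3) (alpha * beta) (a1 * a2) = 1].

Definition projective X : Prop :=
  exists2 g, Inv g & exists alpha beta a1 a2 a3,
    [/\ g X = diag_elt alpha beta a1 a2 a3,
        diagonal_reduced alpha beta a1 a2 a3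
      & diagonal_projective alpha beta a1 a2 a3].

End FreudenthalModule.

(* The exterior cube of Z^6 in the basis e_i /\ e_j /\ e_k with i < j < k. *)
Definition triple : Type :=
  {t : 'I_6 * 'I_6 * 'I_6 | (t.1.1 < t.1.2 < t.2)%N}.
Definition ext3 : Type := {ffun triple -> int}.

HB.instance Definition _ := GRing.Zmodule.on ext3.

Definition wedge (u v w : 'cV[int]_6) : ext3 :=
  [ffun t : triple => let: (i, j, k) := val t in
    \det (\matrix_(r < 3, s < 3)
            (nth 0 [:: u; v; w] s) (nth i [:: i; j; k] r) 0)].

Definition basis_vec (i : 'I_6) : 'cV[int]_6 := delta_mx i 0.

Definition basis3 (i j k : 'I_6) : ext3 :=
  wedge (basis_vec i) (basis_vec j) (basis_vec k).

Definition ext3_act (g : 'M[int]_6) (x : ext3) : ext3 :=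
  \sum_(t : triple) let: (i, j, k) := val t in
    wedge (g *m basis_vec i) (g *m basis_vec j) (g *m basis_vec k) *~ x t.

(* The standard basis of Z^6 is e_1, e_2, e_3, f_1, f_2, f_3. *)
Definition e_ (i : 'I_3) : 'cV[int]_6 := basis_vec (lshift 3 i).
Definition f_ (i : 'I_3) : 'cV[int]_6 := basis_vec (rshift 3 i).

(* u /\ e_j^* and u /\ f_j^*; [ordS] and [ord_pred] are cyclic. *)
Definition wedge_e (u : 'cV[int]_6) (j : 'I_3) : ext3 :=
  wedge u (e_ (ordS j)) (e_ (ord_pred j)).
Definition wedge_f (u : 'cV[int]_6) (j : 'I_3) : ext3 :=
  wedge u (f_ (ordS j)) (f_ (ord_pred j)).

(* Above the diagonal the entry diag (a_ij, a_ji) contributes a_ij and a_ji;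
   the entry below the diagonal is its conjugate diag (a_ji, a_ij). *)
Definition bin_cubic_mx (A : cubic bin_ring) : 'M[int]_3 :=
  \matrix_(i, j) (cubic_mx A i j).1.

Definition mx_bin_cubic (M : 'M[int]_3) : cubic bin_ring :=
  ((M 0 0, M 1 1, M 2 2),
   ((M 1 2, M 2 1), (M 2 0, M 0 2), (M 0 1, M 1 0))).

Definition freudenthal_ext3 (X : freudenthal bin_ring) : ext3 :=
  let: (alpha, beta, A, B) := X in
  wedge (e_ 0) (e_ 1) (e_ 2) *~ alpha + wedge (f_ 0) (f_ 1) (f_ 2) *~ beta
  + \sum_i \sum_j wedge_f (e_ i) j *~ bin_cubic_mx A i j
  + \sum_i \sum_j wedge_e (f_ i) j *~ bin_cubic_mx B i j.

Definition ext3_dot (x y : ext3) : int := \sum_t x t * y t.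

(* The images of the basis of the Freudenthal module are, up to sign, the
   elements of the standard basis of [ext3]. *)
Definition ext3_freudenthal (x : ext3) : freudenthal bin_ring :=
  (ext3_dot x (wedge (e_ 0) (e_ 1) (e_ 2)),
   ext3_dot x (wedge (f_ 0) (f_ 1) (f_ 2)),
   mx_bin_cubic (\matrix_(i, j) ext3_dot x (wedge_f (e_ i) j)),
   mx_bin_cubic (\matrix_(i, j) ext3_dot x (wedge_e (f_ i) j))).

Lemma bin_cubic_mxK : cancel bin_cubic_mx mx_bin_cubic.
Proof.
move=> [[[a b] c] [[[x1 x2] [y1 y2]] [z1 z2]]].
by rewrite /mx_bin_cubic !mxE /= !pair_mulrz /= !mulrzz !mul1r.
Qed.

Lemma mx_bin_cubicK : cancel mx_bin_cubic bin_cubic_mx.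
Proof.
move=> M; apply/matrixP => i j; rewrite !mxE.
have I3 (k : 'I_3) : [\/ k = 0, k = 1 | k = 2].
  by case: k => [[|[|[|//]]] p]; [constructor 1 | constructor 2 | constructor 3];
     apply: val_inj.
by case: (I3 i) => ->; case: (I3 j) => -> //=; rewrite pair_mulrz /= mulrzz mul1r.
Qed.

Lemma mx3_detE (M : 'M[int]_3) :
  \det M = M 0 0 * (M 1 1 * M 2 2 - M 1 2 * M 2 1)
         - M 0 1 * (M 1 0 * M 2 2 - M 1 2 * M 2 0)
         + M 0 2 * (M 1 0 * M 2 1 - M 1 1 * M 2 0).
Proof.
rewrite (expand_det_row _ 0) !big_ord_recl big_ord0 addr0.
rewrite /cofactor !mx2_detE !mxE /= /bump /= expr0 expr1 mul1r mulN1r sqrrN expr1n.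
rewrite mul1r mulrN addrA.
by congr (M _ _ * (M _ _ * M _ _ - M _ _ * M _ _)
          - M _ _ * (M _ _ * M _ _ - M _ _ * M _ _)
          + M _ _ * (M _ _ * M _ _ - M _ _ * M _ _)); apply: val_inj.
Qed.

Lemma bin_cubic_norm A : cubic_norm A = \det (bin_cubic_mx A).
Proof.
case: A => [[[a b] c] [[[x1 x2] [y1 y2]] [z1 z2]]].
rewrite cubic_normE mx3_detE !mxE /= !pair_mulrz /= !mulrzz; ring.
Qed.

Lemma bin_cubic_trace A B :
  cubic_trace A B = \tr (bin_cubic_mx A *m bin_cubic_mx B).
Proof.
case: A B => [[[a b] c] [[[x1 x2] [y1 y2]] [z1 z2]]].
move=> [[[a' b'] c'] [[[x1' x2'] [y1' y2']] [z1' z2']]].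
rewrite /mxtrace !big_ord_recl big_ord0 !mxE !big_ord_recl !big_ord0 !mxE /=.
rewrite !pair_mulrz /= !mulrzz /norm2 /=; ring.
Qed.

Section ExteriorCubeTheory.

Local Notation T i j k := (exist
  (fun t : 'I_6 * 'I_6 * 'I_6 => is_true (t.1.1 < t.1.2 < t.2)%N)
  (@Ordinal 6 i isT, @Ordinal 6 j isT, @Ordinal 6 k isT) isT).

Let triples : seq triple :=
  [:: T 0 1 2; T 0 1 3; T 0 1 4; T 0 1 5; T 0 2 3; T 0 2 4; T 0 2 5; T 0 3 4;
      T 0 3 5; T 0 4 5; T 1 2 3; T 1 2 4; T 1 2 5; T 1 3 4; T 1 3 5; T 1 4 5;
      T 2 3 4; T 2 3 5; T 2 4 5; T 3 4 5].

Let mem_triples (t : triple) : t \in triples.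
Proof.
rewrite -(mem_map val_inj).
case: t => -[[[i pi] [j pj]] [k pk]] /= p.
by case: i pi p => [|[|[|[|[|[|//]]]]]] pi; case: j pj => [|[|[|[|[|[|//]]]]]] pj;
  case: k pk => [|[|[|[|[|[|//]]]]]] pk.
Qed.

Let sum_triples (F : triple -> int) : \sum_t F t = \sum_(t <- triples) F t.
Proof.
apply: perm_big; apply: uniq_perm; rewrite ?index_enum_uniq //.
by move=> t; rewrite mem_index_enum mem_triples.
Qed.

Lemma ext3_mulrz (x : ext3) (k : int) t : (x *~ k) t = x t * k.
Proof.
by rewrite (additive_mulrz (f := fun y : ext3 => y t)) ?mulrzz // => y z;
   rewrite ffunE.
Qed.

Lemma ext3_addE (x y : ext3) t : (x + y) t = x t + y t.
Proof. by rewrite ffunE. Qed.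

Let W (t : triple) (a b c : nat) : int :=
  let: (i, j, k) := val t in
  let d (r s : nat) : int := if r == s then 1 else 0 in
  d i a * (d j b * d k c - d j c * d k b)
  - d i b * (d j a * d k c - d j c * d k a)
  + d i c * (d j a * d k b - d j b * d k a).

Lemma wedgeE u v w t : wedge u v w t =
  let: (i, j, k) := val t in
  u i 0 * (v j 0 * w k 0 - w j 0 * v k 0)
  - v i 0 * (u j 0 * w k 0 - w j 0 * u k 0)
  + w i 0 * (u j 0 * v k 0 - v j 0 * u k 0).
Proof.
by rewrite ffunE; case: (val t) => -[i j] k; rewrite mx3_detE !mxE.
Qed.

Let basis3E a b c t : basis3 a b c t = W t a b c.
Proof.
rewrite /basis3 wedgeE /W; case: (val t) => -[i j] k.
have e (r s : 'I_6) : basis_vec s r 0 = if (r : nat) == s then 1 else 0.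
  by rewrite mxE eqxx andbT -val_eqE; case: ifP.
by rewrite !e.
Qed.

Let int_sum3 (F : 'I_3 -> int) : \sum_i F i = F 0 + F 1 + F 2.
Proof.
rewrite !big_ord_recl big_ord0 addr0 addrA.
by congr (_ + F _ + F _); apply: val_inj.
Qed.

Let wedge_feE i j t : wedge_f (e_ i) j t =
  W t (lshift 3 i) (rshift 3 (ordS j)) (rshift 3 (ord_pred j)).
Proof. exact: basis3E. Qed.

Let wedge_efE i j t : wedge_e (f_ i) j t =
  W t (rshift 3 i) (lshift 3 (ordS j)) (lshift 3 (ord_pred j)).
Proof. exact: basis3E. Qed.

Let freudenthal_ext3E X t :
  freudenthal_ext3 X t =
  let: (alpha, beta, A, B) := X in
  let A := bin_cubic_mx A in let B := bin_cubic_mx B in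
  W t 0 1 2 * alpha + W t 3 4 5 * beta +
  (W t 0 4 5 * A 0 0 + W t 0 5 3 * A 0 1 + W t 0 3 4 * A 0 2 +
   (W t 1 4 5 * A 1 0 + W t 1 5 3 * A 1 1 + W t 1 3 4 * A 1 2) +
   (W t 2 4 5 * A 2 0 + W t 2 5 3 * A 2 1 + W t 2 3 4 * A 2 2)) +
  (W t 3 1 2 * B 0 0 + W t 3 2 0 * B 0 1 + W t 3 0 1 * B 0 2 +
   (W t 4 1 2 * B 1 0 + W t 4 2 0 * B 1 1 + W t 4 0 1 * B 1 2) +
   (W t 5 1 2 * B 2 0 + W t 5 2 0 * B 2 1 + W t 5 0 1 * B 2 2)).
Proof.
case: X => [[[alpha beta] A] B]; rewrite /freudenthal_ext3.
move: (bin_cubic_mx A) (bin_cubic_mx B) => {}A {}B.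
have sumE (F G : 'I_3 -> 'I_3 -> int) (H : 'I_3 -> 'I_3 -> ext3) :
    (forall i j, H i j t = F i j) ->
    (\sum_i \sum_j H i j *~ G i j) t = \sum_i \sum_j F i j * G i j.
  move=> e; rewrite sum_ffunE; apply: eq_bigr => i _.
  by rewrite sum_ffunE; apply: eq_bigr => j _; rewrite ext3_mulrz e.
rewrite 3!ext3_addE 2!ext3_mulrz (sumE _ _ _ (fun i j => wedge_feE i j t)).
rewrite (sumE _ _ _ (fun i j => wedge_efE i j t)) 8!int_sum3.
by rewrite [wedge (e_ _) _ _ _]basis3E [wedge (f_ _) _ _ _]basis3E.
Qed.

Let dot1 x (a b c : 'I_6) t0 (s : int) :
  W t0 a b c = s -> all (fun t => (t == t0) || (W t a b c == 0)) triples ->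
  ext3_dot x (basis3 a b c) = x t0 * s.
Proof.
move=> <- /allP W0; rewrite /ext3_dot (bigD1 t0) //= basis3E big1 ?addr0 //.
move=> t /negPf nt; move: (W0 t (mem_triples t)).
by rewrite nt basis3E => /eqP ->; rewrite mulr0.
Qed.

Let tabA (x : ext3) : 'M[int]_3 := \matrix_(i, j)
  nth 0 (nth [::] [:: [:: x (T 0 4 5); - x (T 0 3 5); x (T 0 3 4)];
                      [:: x (T 1 4 5); - x (T 1 3 5); x (T 1 3 4)];
                      [:: x (T 2 4 5); - x (T 2 3 5); x (T 2 3 4)]] i) j.

Let tabB (x : ext3) : 'M[int]_3 := \matrix_(i, j)
  nth 0 (nth [::] [:: [:: x (T 1 2 3); - x (T 0 2 3); x (T 0 1 3)];
                      [:: x (T 1 2 4); - x (T 0 2 4); x (T 0 1 4)];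
                      [:: x (T 1 2 5); - x (T 0 2 5); x (T 0 1 5)]] i) j.

Let ord3P (k : 'I_3) : [\/ k = 0, k = 1 | k = 2].
Proof.
by case: k => [[|[|[|//]]] p]; [constructor 1 | constructor 2 | constructor 3];
   apply: val_inj.
Qed.

Let ext3_freudenthalE x : ext3_freudenthal x =
  (x (T 0 1 2), x (T 3 4 5), mx_bin_cubic (tabA x), mx_bin_cubic (tabB x)).
Proof.
rewrite /ext3_freudenthal; congr (_, _, mx_bin_cubic _, mx_bin_cubic _).
- by rewrite (@dot1 x _ _ _ (T 0 1 2) 1) ?mulr1.
- by rewrite (@dot1 x _ _ _ (T 3 4 5) 1) ?mulr1.
- apply/matrixP => i j; rewrite !mxE.
  by case: (ord3P i) => ->; case: (ord3P j) => -> /=;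
     (rewrite -[RHS]mulr1; apply: dot1; by vm_compute)
     || (rewrite -mulrN1; apply: dot1; by vm_compute).
- apply/matrixP => i j; rewrite !mxE.
  by case: (ord3P i) => ->; case: (ord3P j) => -> /=;
     (rewrite -[RHS]mulr1; apply: dot1; by vm_compute)
     || (rewrite -mulrN1; apply: dot1; by vm_compute).
Qed.

Local Ltac simpW := repeat
  match goal with |- context [W ?t ?a ?b ?c] =>
    let v := eval vm_compute in (W t a b c) in
    match v with
    | Posz 0 => change (W t a b c) with (0 : int)
    | Posz 1 => change (W t a b c) with (1 : int)
    | _ => change (W t a b c) with (- 1 : int)
    end
  end.

Lemma freudenthal_ext3K : cancel freudenthal_ext3 ext3_freudenthal.
Proof.
case=> [[[alpha beta] A] B]; set X := (alpha, beta, A, B).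
rewrite ext3_freudenthalE.
have XE t := freudenthal_ext3E X t; move: (freudenthal_ext3 X) XE => x /= XE.
rewrite /X -[in RHS](bin_cubic_mxK A) -[in RHS](bin_cubic_mxK B).
congr (_, _, mx_bin_cubic _, mx_bin_cubic _).
- by rewrite XE; simpW; ring.
- by rewrite XE; simpW; ring.
- apply/matrixP => i j; rewrite [LHS]mxE.
  by case: (ord3P i) => ->; case: (ord3P j) => -> /=; rewrite XE; simpW; ring.
- apply/matrixP => i j; rewrite [LHS]mxE.
  by case: (ord3P i) => ->; case: (ord3P j) => -> /=; rewrite XE; simpW; ring.
Qed.

Lemma ext3_freudenthalK : cancel ext3_freudenthal freudenthal_ext3.
Proof.
move=> x; apply/ffunP => t; rewrite ext3_freudenthalE freudenthal_ext3E.
rewrite !mx_bin_cubicK /= !mxE /=; move: (mem_triples t).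
by rewrite !inE; do 19?[case/orP]; move/eqP->; simpW; ring.
Qed.

Lemma freudenthal_ext3_linear (k : int) X Y :
  freudenthal_ext3 (X *~ k + Y) = freudenthal_ext3 X *~ k + freudenthal_ext3 Y.
Proof.
have mxD i j : {morph (fun A => bin_cubic_mx A i j) : A B / A + B}.
  move=> [[[a b] c] [[[x1 x2] [y1 y2]] [z1 z2]]].
  move=> [[[a' b'] c'] [[[x1' x2'] [y1' y2']] [z1' z2']]]; rewrite cubicDE !mxE.
  by case: (ord3P i) => ->; case: (ord3P j) => -> //=;
     rewrite !pair_mulrz /= !mulrzz !mul1r.
have mxE' A B i j :
    bin_cubic_mx (A *~ k + B) i j = bin_cubic_mx A i j * k + bin_cubic_mx B i j.
  by rewrite [LHS]mxD (additive_mulrz (mxD i j)) mulrzz.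
apply/ffunP => t; rewrite [RHS]ext3_addE (ext3_mulrz (freudenthal_ext3 X)).
case: X Y => [[[a b] A] B] [[[a' b'] A'] B'].
have -> : (a, b, A, B) *~ k + (a', b', A', B') =
    (a *~ k + a', b *~ k + b', A *~ k + A', B *~ k + B') :> freudenthal _.
  by rewrite !pair_mulrz.
by rewrite !freudenthal_ext3E; cbv zeta; rewrite !mxE' !mulrzz; ring.
Qed.

Lemma ext3_act_wedge g u v w :
  ext3_act g (wedge u v w) = wedge (g *m u) (g *m v) (g *m w).
Proof.
have gE (s : 'I_6) i : (g *m basis_vec s) i 0 = g i s.
  rewrite mxE (bigD1 s) //= big1 ?addr0 ?mxE ?eqxx ?mulr1 // => j /negPf js.
  by rewrite mxE js mulr0.
pose o k p : 'I_6 := @Ordinal 6 k p.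
have mulE (z : 'cV[int]_6) i : (g *m z) i 0 =
    g i (o 0 isT) * z (o 0 isT) 0 + g i (o 1 isT) * z (o 1 isT) 0
    + g i (o 2 isT) * z (o 2 isT) 0 + g i (o 3 isT) * z (o 3 isT) 0
    + g i (o 4 isT) * z (o 4 isT) 0 + g i (o 5 isT) * z (o 5 isT) 0.
  rewrite mxE !big_ord_recl big_ord0 addr0 !addrA.
  by congr (g _ _ * z _ _ + g _ _ * z _ _ + g _ _ * z _ _ + g _ _ * z _ _
            + g _ _ * z _ _ + g _ _ * z _ _); apply: val_inj.
apply/ffunP => t; rewrite /ext3_act sum_ffunE.
pose F (s : triple) := let: (a, b, c) := val s in
  (let: (i, j, k) := val t in
   g i a * (g j b * g k c - g j c * g k b)
   - g i b * (g j a * g k c - g j c * g k a)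
   + g i c * (g j a * g k b - g j b * g k a)) *
  (u a 0 * (v b 0 * w c 0 - w b 0 * v c 0)
   - v a 0 * (u b 0 * w c 0 - w b 0 * u c 0)
   + w a 0 * (u b 0 * v c 0 - v b 0 * u c 0)).
transitivity (\sum_s F s).
  apply: eq_bigr => s _; rewrite [wedge u v w s]wedgeE /F.
  case: (val s) => -[a b] c; rewrite ext3_mulrz wedgeE.
  by case: (val t) => -[i j] k; rewrite !gE; congr (_ * _); ring.
rewrite sum_triples /triples !big_cons big_nil wedgeE /F.
case: (val t) => -[i j] k; rewrite /= !mulE /o.
move: (@Ordinal 6 0 isT) (@Ordinal 6 1 isT) (@Ordinal 6 2 isT).
move: (@Ordinal 6 3 isT) (@Ordinal 6 4 isT) (@Ordinal 6 5 isT) => o3 o4 o5 o0 o1 o2.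
ring.
Qed.

End ExteriorCubeTheory.

(* The elements of [ap_elt] satisfying [ap_group] form the group. *)
Record action_pair := ActionPair {
  ap_elt : Type;
  ap_group : ap_elt -> Prop;
  ap_module : Type;
  ap_act : ap_elt -> ap_module -> ap_module;
  ap_norm : ap_module -> int;
  ap_projective : ap_module -> Prop
}.

Definition SL6_pair : action_pair :=
  @ActionPair 'M[int]_6 (fun g => \det g = 1) ext3 ext3_act
    (fun x => quartic (ext3_freudenthal x))
    (fun x => projective (ext3_freudenthal x)).

Definition Inv_pair (C : comp_ring) : action_pair :=
  @ActionPair (freudenthal C -> freudenthal C) (@Inv C) (freudenthal C)
    (fun g X => g X) (@quartic C) (@projective C).

Definition D6_pair : action_pair := Inv_pair quat_ring.
Definition E7_pair : action_pair := Inv_pair oct_ring.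

(* As in [transitive G, on S | to]: S is stable and is a single orbit. *)
Definition acts_transitively (P : action_pair) (S : ap_module P -> Prop) : Prop :=
  [/\ forall g x, ap_group g -> S x -> S (ap_act g x),
      exists x, S x
    & forall x y, S x -> S y -> exists2 g, ap_group g & ap_act g x = y].

Definition zero_or_one_mod4 (n : int) : Prop :=
  (n = 0 %[mod 4])%Z \/ (n = 1 %[mod 4])%Z.

Definition squarefree (n : int) : Prop :=
  forall d : int, (d ^+ 2 %| n)%Z -> `|d| = 1.

Definition fundamental_discriminant (n : int) : Prop :=
  (squarefree n /\ (n = 1 %[mod 4])%Z) \/
  exists k : int, [/\ n = 4 * k, squarefree k
    & (k = 2 %[mod 4])%Z \/ (k = 3 %[mod 4])%Z].

(* Main.v *)
Require Import Defs.
From mathcomp Require Import all_boot all_order all_algebra.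
From mathcomp Require Import ring zify.
From Stdlib Require Import Classical.

Set Implicit Arguments.
Unset Strict Implicit.
Unset Printing Implicit Defensive.

Import Order.TTheory GRing.Theory Num.Theory.
Local Open Scope ring_scope.

(** The norm is 4 k + s ^ 2, which gives the congruence. For the orbits, the idea
    is reduction theory: every element that matters is moved to
      [normal_form n] = (1, n mod 4, diag (n div 4, 1, 1), 0),
    which depends on the norm n only.

    The moves are Freudenthal's translation by diag (t, 0, 0), the duality
    (alpha, beta, A, B) |-> (- beta, alpha, - B, A), the cyclic permutation of the
    three indices, and the shears A |-> P A P^* with P = 1 + u E_12. They lie in
    Inv because the norm of C is multiplicative, which already implies the
    alternative laws ([translation_Inv], [duality_Inv], [rotation_Inv],
    [shear_Inv]).

    Projectivity is replaced by an intrinsic condition, [maximal]: for no prime p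
    are the norms of all elements congruent to X modulo p equal to p ^ 2 times an
    integer that is 0 or 1 modulo 4. As it is stated in terms of the norm, it is
    invariant under Inv; an element of fundamental norm satisfies it by the very definition
    of a fundamental discriminant ([fundamental_maximal]); and a diagonal reduced
    projective element satisfies it by its gcd conditions ([projective_maximal]).

    A maximal element is reduced as follows ([reduce_to_normal_form]). A smallest
    nonzero first coordinate in the orbit divides the coordinates of B, and then of
    A, by the Euclidean algorithm ([pivot_min_dvd]); a prime factor of it would
    contradict maximality, so the element becomes (1, beta, diag (a, b, c), 0)
    ([reduce_to_diag], [diagonalize]). Maximality now says that no prime divides
    beta and two of a, b, c ([maximal_unramified]). The moves
    a |-> a + t beta - t ^ 2 b c of [diag_shift] make a, b, c coprime and then, once
    a = 1, make b, c coprime; the Smith normal form ([diag_gcd]) turns this into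
    diag (k, 1, 1), and a last move brings beta into {0, 1}. Any two maximal
    elements of norm n are thus equivalent.

    For SL6 the acting group is smaller than Inv, so two things remain: the moves
    are realized by matrices of determinant 1 ([translation_realized] and the like,
    by comparing wedge products of arbitrary vectors), and conversely SL6 acts
    through Inv ([SL6_acts_in_Inv]), since it is generated by transvections
    ([SL_generated]), which are conjugates and commutators of the moves. *)

(** * Composition rings and generators of Inv *)

Section Composition.
Local Open Scope comp_scope.
Variable C : comp_ring.
Implicit Types (x y z u w : C) (k : int).

Lemma cr_mulzl x y k : (x *~ k) ∘ y = (x ∘ y) *~ k.
Proof. by rewrite (additive_mulrz (f := fun u => u ∘ y)) // => u v; rewrite cr_mulDl. Qed.

Lemma cr_mulzr x y k : x ∘ (y *~ k) = (x ∘ y) *~ k.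
Proof. by rewrite (additive_mulrz (f := fun u => x ∘ u)) // => u v; rewrite cr_mulDr. Qed.

Lemma cr_conjz x k : (x *~ k)^† = x^† *~ k.
Proof. by rewrite (additive_mulrz (@cr_conjD C)). Qed.

Lemma cr_mulNl x y : (- x) ∘ y = - (x ∘ y).
Proof. by rewrite -mulrN1z cr_mulzl mulrN1z. Qed.

Lemma cr_mulNr x y : x ∘ (- y) = - (x ∘ y).
Proof. by rewrite -mulrN1z cr_mulzr mulrN1z. Qed.

Lemma cr_conjN x : (- x)^† = - x^†.
Proof. by rewrite -mulrN1z cr_conjz mulrN1z. Qed.

Lemma cr_conj0 : (0 : C)^† = 0.
Proof. by rewrite -[0 in LHS](mulr0z (0 : C)) cr_conjz mulr0z. Qed.

Lemma cr_mul0l x : 0 ∘ x = 0.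
Proof. by rewrite -[0 in LHS](mulr0z (0 : C)) cr_mulzl mulr0z. Qed.

Lemma cr_mul0r x : x ∘ 0 = 0.
Proof. by rewrite -[0 in LHS](mulr0z (0 : C)) cr_mulzr mulr0z. Qed.

Lemma norm2zr x y k : norm2 x (y *~ k) = k * norm2 x y.
Proof. by rewrite norm2C norm2zl norm2C. Qed.

Lemma norm2Nl x y : norm2 (- x) y = - norm2 x y.
Proof. by rewrite -mulrN1z norm2zl mulN1r. Qed.

Lemma norm2Nr x y : norm2 x (- y) = - norm2 x y.
Proof. by rewrite norm2C norm2Nl norm2C. Qed.

Lemma norm20 x : norm2 x 0 = 0.
Proof. by rewrite -[0 in LHS](mulr0z (0 : C)) norm2zr mul0r. Qed.

Lemma norm02 x : norm2 0 x = 0.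
Proof. by rewrite norm2C norm20. Qed.

Lemma cr_normz x k : cr_norm (x *~ k) = k * k * cr_norm x.
Proof. by have := norm2xx (x *~ k); rewrite norm2zl norm2zr norm2xx; lia. Qed.

Lemma cr_normN x : cr_norm (- x) = cr_norm x.
Proof. by rewrite -mulrN1z cr_normz; ring. Qed.

Lemma cr_norm0 : cr_norm (0 : C) = 0.
Proof. by have := norm2xx (0 : C); rewrite norm20; lia. Qed.

Lemma cr_tracez x k : cr_trace (x *~ k) = k * cr_trace x.
Proof. by rewrite (additive_mulrz (@cr_traceD C)) mulrzz mulrC. Qed.

Lemma cr_traceN x : cr_trace (- x) = - cr_trace x.
Proof. by rewrite -mulrN1z cr_tracez mulN1r. Qed.

Lemma cr_trace0 : cr_trace (0 : C) = 0.
Proof. by rewrite -[0 in LHS](mulr0z (0 : C)) cr_tracez mul0r. Qed.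

Lemma norm2_conjC x y : norm2 x^† y^† = norm2 x y.
Proof. by rewrite norm2_conj cr_traceC -norm2E norm2C. Qed.

Lemma cr_norm_conj x : cr_norm x^† = cr_norm x.
Proof. by have := norm2xx x^†; rewrite norm2_conjC norm2xx; lia. Qed.

Lemma norm2_inj x x' : norm2 x =1 norm2 x' -> x = x'.
Proof.
move=> e; apply/eqP; rewrite -subr_eq0; apply/eqP/cr_nondeg => y.
by rewrite -/(norm2 _ y) norm2Dl e norm2Nl subrr.
Qed.

Lemma norm2_conj_mul3 x y z :
  norm2 (x ∘ y)^† z = cr_trace ((x ∘ y) ∘ z).
Proof. by rewrite norm2C norm2_conj cr_traceC. Qed.

Lemma cr_trace_rot x y z : cr_trace ((y ∘ z) ∘ x) = cr_trace ((x ∘ y) ∘ z).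
Proof. by rewrite cr_traceC -cr_traceA. Qed.

Hypothesis normM : forall x y, cr_norm (x ∘ y) = cr_norm x * cr_norm y.

Lemma norm2_mull x y z : norm2 (x ∘ y) (x ∘ z) = cr_norm x * norm2 y z.
Proof. by rewrite /norm2 -cr_mulDr !normM; ring. Qed.

Lemma norm2_mulr x y z : norm2 (x ∘ z) (y ∘ z) = cr_norm z * norm2 x y.
Proof. by rewrite /norm2 -cr_mulDl !normM; ring. Qed.

(** By adjunction against the nondegenerate form, n(xy, xz) = n(x) n(y, z) turns
    into this alternative law; no associativity is involved, so that octonions
    are covered. *)
Lemma cr_conj_mulK x y : x^† ∘ (x ∘ y) = y *~ cr_norm x.
Proof.
apply: norm2_inj => z; rewrite norm2zl -norm2_mull !norm2E cr_traceA.
by rewrite [LHS]cr_traceC cr_traceA -cr_conjM.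
Qed.

Lemma cr_mulK_conj x y : x ∘ (x^† ∘ y) = y *~ cr_norm x.
Proof. by rewrite -{1}[x]cr_conjK cr_conj_mulK cr_norm_conj. Qed.

Lemma cr_mul_conjK x y : (y ∘ x^†) ∘ x = y *~ cr_norm x.
Proof.
apply: (can_inj (@cr_conjK C)).
by rewrite !cr_conjM cr_conjK cr_conj_mulK cr_conjz.
Qed.

End Composition.

Section Moves.
Local Open Scope comp_scope.
Variable C : comp_ring.
Implicit Types (A B : cubic C) (X Y : freudenthal C) (u w : C) (t : int).

(** The action A |-> P A P^* of P = 1 + u E_12 on Hermitian matrices. *)
Definition upper_shear u A : cubic C :=
  let: ((a, b, c), (x, y, z)) := A in
  ((a + norm2 z u + cr_norm u * b, b, c), (x, y + x^† ∘ u^†, z + u *~ b)).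

(** The action A |-> P A P^* of P = 1 + u^† E_21; the conjugation makes the
    off-diagonal entry transform by u itself, as in [upper_shear]. *)
Definition lower_shear u A : cubic C :=
  let: ((a, b, c), (x, y, z)) := A in
  ((a, b + norm2 z u + cr_norm u * a, c), (x + u^† ∘ y^†, y, z + u *~ a)).

Definition rot3 A : cubic C :=
  let: ((a, b, c), (x, y, z)) := A in ((b, c, a), (y, z, x)).

(** Freudenthal's translation by C = diag (t, 0, 0): as C^# = 0, it sends
    (alpha, beta, A, B) to (alpha + (B, C), beta, A + beta C, B + A x C). *)
Definition translation t X : freudenthal C :=
  let: (al, be, ((a, b, c), (x, y, z)), ((a', b', c'), (x', y', z'))) := X in
  (al + t * a', be, ((a + t * be, b, c), (x, y, z)),
   ((a', b' + t * c, c' + t * b), (x' - x *~ t, y', z'))).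

Definition duality X : freudenthal C :=
  let: (al, be, A, B) := X in (- be, al, - B, A).

Definition rotation X : freudenthal C :=
  let: (al, be, A, B) := X in (al, be, rot3 A, rot3 B).

(** The adjoint of the inverse of [upper_shear u] for the trace form is
    [lower_shear (- u)]. *)
Definition shear u X : freudenthal C :=
  let: (al, be, A, B) := X in (al, be, upper_shear u A, lower_shear (- u) B).

End Moves.

Section Invariance.
Local Open Scope comp_scope.
Variable C : comp_ring.
Hypothesis normM : forall x y : C, cr_norm (x ∘ y) = cr_norm x * cr_norm y.
Implicit Types (A B : cubic C) (X Y : freudenthal C) (u w : C) (t : int).

Definition cr_linE := (norm2Dl, norm2Dr, norm2zl, norm2zr, norm2Nl, norm2Nr,
  cr_normD, cr_normz, cr_normN, cr_mulDl, cr_mulDr, cr_mulNl, cr_mulNr,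
  cr_mulzl, cr_mulzr, cr_conjD, cr_conjN, cr_conjz).

(** The terms that survive the expansion are n(zx, z'x) and n(xy, xy'), which
    multiplicativity of the norm reduces to n(x) n(z, z') and n(x) n(y, y'). *)
Lemma quartic_translation t X : quartic (translation t X) = quartic X.
Proof.
case: X => [[[al be] [[[a b] c] [[x y] z]]] [[[a' b'] c'] [[x' y'] z']]].
rewrite /quartic /translation !sharpE !cubic_normE /cubic_trace.
rewrite !cr_linE !(cr_traceD, cr_traceN, cr_tracez).
rewrite !norm2_conjC ?norm2_mull // ?norm2_mulr //.
rewrite !(norm2C x' x) !(norm2C _ (_ ∘ _)^†) !norm2_conj_mul3 !norm2xx.
rewrite !(cr_trace_rot x y z) !(cr_trace_rot x' y z) !(cr_trace_rot x y' z').
rewrite !(cr_trace_rot y' z x) !(cr_trace_rot y z' x') !(cr_trace_rot y z' x).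
rewrite !(cr_trace_rot x y' z) !(cr_trace_rot x' y z') !(cr_trace_rot x y z'); ring.
Qed.

Lemma skew_translation t X Y :
  skew_form (translation t X) (translation t Y) = skew_form X Y.
Proof.
case: X => [[[al be] [[[a b] c] [[x y] z]]] [[[a' b'] c'] [[x' y'] z']]].
case: Y => [[[ga de] [[[d e] f] [[p q] r]]] [[[d' e'] f'] [[p' q'] r']]].
rewrite /skew_form /translation /cubic_trace !cr_linE; ring.
Qed.

Lemma cubic_normN A : cubic_norm (- A) = - cubic_norm A.
Proof.
case: A => [[[a b] c] [[x y] z]].
have -> : - (a, b, c, (x, y, z)) = (- a, - b, - c, (- x, - y, - z)) :> cubic C by [].
rewrite !cubic_normE !cr_linE !cr_traceN; ring.
Qed.

Lemma sharpN A : sharp (- A) = sharp A.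
Proof.
case: A => [[[a b] c] [[x y] z]].
have -> : - (a, b, c, (x, y, z)) = (- a, - b, - c, (- x, - y, - z)) :> cubic C by [].
by rewrite !sharpE !cr_linE !mulrNN !opprK !mulrNz !mulNrz !opprK.
Qed.

Lemma cubic_traceNl A B : cubic_trace (- A) B = - cubic_trace A B.
Proof.
case: A B => [[[a b] c] [[x y] z]] [[[a' b'] c'] [[x' y'] z']].
rewrite /cubic_trace /= !cr_linE; ring.
Qed.

Lemma cubic_traceC A B : cubic_trace A B = cubic_trace B A.
Proof.
case: A B => [[[a b] c] [[x y] z]] [[[a' b'] c'] [[x' y'] z']].
by rewrite /cubic_trace (norm2C x) (norm2C y) (norm2C z) (mulrC a) (mulrC b) (mulrC c).
Qed.

Lemma quartic_duality X : quartic (duality X) = quartic X.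
Proof.
case: X => [[[al be] A] B]; rewrite /quartic /duality sharpN cubic_normN.
rewrite cubic_traceNl (cubic_traceC (sharp B)) (cubic_traceC B); ring.
Qed.

Lemma skew_duality X Y : skew_form (duality X) (duality Y) = skew_form X Y.
Proof.
case: X Y => [[[al be] A] B] [[[ga de] A'] B'].
rewrite /skew_form /duality (cubic_traceC A (- B')) !cubic_traceNl.
rewrite (cubic_traceC B' A); ring.
Qed.

Lemma cubic_trace_rot3 A B : cubic_trace (rot3 A) (rot3 B) = cubic_trace A B.
Proof.
case: A B => [[[a b] c] [[x y] z]] [[[a' b'] c'] [[x' y'] z']].
rewrite /cubic_trace /=; ring.
Qed.

Lemma cubic_norm_rot3 A : cubic_norm (rot3 A) = cubic_norm A.
Proof. case: A => [[[a b] c] [[x y] z]]; rewrite !cubic_normE cr_trace_rot; ring. Qed.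

Lemma sharp_rot3 A : sharp (rot3 A) = rot3 (sharp A).
Proof. by case: A => [[[a b] c] [[x y] z]]; rewrite /rot3 !sharpE. Qed.

Lemma quartic_rotation X : quartic (rotation X) = quartic X.
Proof.
case: X => [[[al be] A] B].
by rewrite /quartic /rotation !sharp_rot3 !cubic_norm_rot3 !cubic_trace_rot3.
Qed.

Lemma skew_rotation X Y : skew_form (rotation X) (rotation Y) = skew_form X Y.
Proof.
by case: X Y => [[[al be] A] B] [[[ga de] A'] B']; rewrite /skew_form /= !cubic_trace_rot3.
Qed.

(** The alternative laws make the non-associative triple products that the
    change of variables creates collapse to multiples of n(x) and n(u). *)
Lemma cubic_norm_upper u A : cubic_norm (upper_shear u A) = cubic_norm A.
Proof.
case: A => [[[a b] c] [[x y] z]]; rewrite /upper_shear !cubic_normE !cr_linE.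
rewrite !normM !cr_norm_conj !cr_mulK_conj // !cr_traceD !cr_tracez.
rewrite !cr_mulzl !cr_tracez.
have -> : norm2 y (x^† ∘ u^†) = cr_trace ((x ∘ y) ∘ u).
  by rewrite -cr_conjM norm2C norm2_conj_mul3 (cr_trace_rot _ u x) (cr_trace_rot _ y u).
rewrite ![cr_trace (u^† ∘ _)]cr_traceC -!norm2E norm2xx; ring.
Qed.

Lemma cubic_norm_lower u A : cubic_norm (lower_shear u A) = cubic_norm A.
Proof.
case: A => [[[a b] c] [[x y] z]]; rewrite /lower_shear !cubic_normE !cr_linE.
rewrite !normM !cr_norm_conj !cr_mul_conjK // !cr_traceD !cr_tracez.
rewrite !cr_mulzl !cr_tracez.
have -> : norm2 x (u^† ∘ y^†) = cr_trace ((x ∘ y) ∘ u).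
  by rewrite -cr_conjM norm2_conj cr_traceA.
rewrite ![cr_trace (u^† ∘ _)]cr_traceC -!norm2E norm2xx; ring.
Qed.

Lemma cubic_trace_shear u A B :
  cubic_trace (upper_shear u A) (lower_shear (- u) B) = cubic_trace A B.
Proof.
case: A B => [[[a b] c] [[x y] z]] [[[a' b'] c'] [[x' y'] z']].
rewrite /cubic_trace /upper_shear /lower_shear !cr_linE ?norm2xx.
have -> : norm2 x (u^† ∘ y'^†) = norm2 (x^† ∘ u^†) y'.
  by rewrite -norm2_conjC cr_conjM !cr_conjK !norm2E cr_conjM cr_traceA.
rewrite (norm2C u z'); ring.
Qed.

Lemma upper_shearD u : {morph upper_shear u : A B / A + B}.
Proof.
move=> [[[a b] c] [[x y] z]] [[[a' b'] c'] [[x' y'] z']].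
rewrite cubicDE /upper_shear cubicDE !cr_linE mulrzDr.
congr (_, _, _, (_, _, _)); first ring.
- by rewrite addrACA.
- by rewrite addrACA.
Qed.

Lemma lower_shearD u : {morph lower_shear u : A B / A + B}.
Proof.
move=> [[[a b] c] [[x y] z]] [[[a' b'] c'] [[x' y'] z']].
rewrite cubicDE /lower_shear cubicDE !cr_linE mulrzDr.
congr (_, _, _, (_, _, _)); first ring.
- by rewrite addrACA.
- by rewrite addrACA.
Qed.

Lemma cubicN a b c (x y z : C) :
  - ((a, b, c), (x, y, z)) = ((- a, - b, - c), (- x, - y, - z)) :> cubic C.
Proof. by []. Qed.

Lemma upper_shearK u : cancel (upper_shear u) (upper_shear (- u)).
Proof.
move=> [[[a b] c] [[x y] z]]; rewrite /upper_shear !cr_linE !norm2xx mulNrz.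
congr (_, _, _, (_, _, _)); [ring | | ]; by rewrite ?cr_mulNr addrK.
Qed.

Lemma lower_shearK u : cancel (lower_shear u) (lower_shear (- u)).
Proof.
move=> [[[a b] c] [[x y] z]]; rewrite /lower_shear !cr_linE !norm2xx mulNrz.
congr (_, _, _, (_, _, _)); [ring | | ]; by rewrite ?cr_mulNl addrK.
Qed.

(** The cubic norm and the trace form determine the sharp map, which is therefore
    natural for the linear maps that preserve the norm. *)
Lemma sharp_adjoint (s s' : cubic C -> cubic C) :
  {morph s : A B / A + B} -> (exists r, cancel r s) ->
  (forall A, cubic_norm (s A) = cubic_norm A) ->
  (forall A B, cubic_trace (s A) (s' B) = cubic_trace A B) ->
  forall A, sharp (s A) = s' (sharp A).
Proof.
move=> sD [r rK] sN ss' A; apply: cubic_trace_inj => B.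
rewrite -[B]rK [RHS]cubic_traceC ss' [RHS]cubic_traceC.
apply: (@intr_inj rat); rewrite !sharpP /cubic_tri.
by rewrite -!sD !sN.
Qed.

Lemma quartic_shear u X : quartic (shear u X) = quartic X.
Proof.
case: X => [[[al be] A] B]; rewrite /quartic /shear.
have e1 : sharp (upper_shear u A) = lower_shear (- u) (sharp A).
  apply: sharp_adjoint; [exact: upper_shearD | | exact: cubic_norm_upper |].
    by exists (upper_shear (- u)) => A'; rewrite -{1}[u]opprK upper_shearK.
  exact: cubic_trace_shear.
have e2 : sharp (lower_shear (- u) B) = upper_shear u (sharp B).
  apply: sharp_adjoint; [exact: lower_shearD | | exact: cubic_norm_lower |].
    by exists (lower_shear u) => A'; rewrite lower_shearK.
  by move=> A' B'; rewrite cubic_traceC cubic_trace_shear cubic_traceC.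
rewrite e1 e2 cubic_norm_upper cubic_norm_lower cubic_trace_shear.
by rewrite (cubic_traceC (lower_shear _ _)) cubic_trace_shear (cubic_traceC (sharp B)).
Qed.

Lemma skew_shear u X Y : skew_form (shear u X) (shear u Y) = skew_form X Y.
Proof.
case: X Y => [[[al be] A] B] [[[ga de] A'] B']; rewrite /skew_form /shear.
rewrite cubic_trace_shear (cubic_traceC (lower_shear _ _)) cubic_trace_shear.
by rewrite (cubic_traceC A').
Qed.

Lemma additive_Inv (g h : freudenthal C -> freudenthal C) :
    {morph g : X Y / X + Y} -> cancel g h -> cancel h g ->
    (forall X, quartic (g X) = quartic X) ->
    (forall X Y, skew_form (g X) (g Y) = skew_form X Y) ->
  Inv g.
Proof.
move=> gD gK hK gq gs; split=> // [k X Y|]; last by exists h.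
by rewrite gD (additive_mulrz gD).
Qed.

Lemma freudenthalDE al be A B al' be' A' B' :
  (al, be, A, B) + (al', be', A', B') =
  (al + al', be + be', A + A', B + B') :> freudenthal C.
Proof. by []. Qed.

Lemma translation_Inv t : Inv (translation t : freudenthal C -> _).
Proof.
have tK s : cancel (@translation C s) (translation (- s)).
  case=> [[[al be] [[[a b] c] [[x y] z]]] [[[a' b'] c'] [[x' y'] z']]].
  rewrite /translation mulrNz opprK subrK.
  congr (_, _, (_, _, _, _), (_, _, _, _)); ring.
apply: (additive_Inv _ (tK t)) => [||X|X Y].
- case=> [[[al be] [[[a b] c] [[x y] z]]] [[[a' b'] c'] [[x' y'] z']]].
  case=> [[[ga de] [[[d e] f] [[p q] r]]] [[[d' e'] f'] [[p' q'] r']]].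
  rewrite freudenthalDE !cubicDE /translation freudenthalDE !cubicDE.
  rewrite mulrzDl opprD (addrACA x').
  congr (_, _, (_, _, _, _), (_, _, _, _)); ring.
- by move=> X; rewrite -{1}[t]opprK tK.
- exact: quartic_translation.
- exact: skew_translation.
Qed.

Lemma duality_Inv : Inv (@duality C).
Proof.
apply: (@additive_Inv _ (fun X => let: (al, be, A, B) := X in (be, - al, B, - A))).
- move=> [[[al be] A] B] [[[al' be'] A'] B'].
  by rewrite /duality !freudenthalDE !opprD.
- by move=> [[[al be] A] B]; rewrite /duality !opprK.
- by move=> [[[al be] A] B]; rewrite /duality !opprK.
- exact: quartic_duality.
- exact: skew_duality.
Qed.

Lemma rotation_Inv : Inv (@rotation C).
Proof.
apply: (@additive_Inv _ (@rotation C \o @rotation C)).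
- case=> [[[al be] [[[a b] c] [[x y] z]]] [[[a' b'] c'] [[x' y'] z']]].
  by case=> [[[ga de] [[[d e] f] [[p q] r]]] [[[d' e'] f'] [[p' q'] r']]].
- by case=> [[[al be] [[[a b] c] [[x y] z]]] [[[a' b'] c'] [[x' y'] z']]].
- by case=> [[[al be] [[[a b] c] [[x y] z]]] [[[a' b'] c'] [[x' y'] z']]].
- exact: quartic_rotation.
- exact: skew_rotation.
Qed.

Lemma shear_Inv u : Inv (shear u).
Proof.
have shearK w : cancel (shear w) (shear (- w)).
  move=> [[[al be] A] B]; rewrite /shear upper_shearK.
  by rewrite lower_shearK.
apply: (additive_Inv _ (shearK u)).
- move=> [[[al be] A] B] [[[al' be'] A'] B'].
  by rewrite /shear !freudenthalDE upper_shearD lower_shearD.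
- by move=> X; rewrite -{1}[u]opprK shearK.
- exact: quartic_shear.
- exact: skew_shear.
Qed.

End Invariance.

Section InvGroup.
Variable C : comp_ring.
Implicit Types (g h : freudenthal C -> freudenthal C).

Lemma Inv_id : Inv (@id (freudenthal C)).
Proof. by split=> //; exists id. Qed.

Lemma Inv_comp g h : Inv g -> Inv h -> Inv (fun X => g (h X)).
Proof.
move=> [gl gb gq gs] [hl hb hq hs]; split=> [k X Y||X|X Y].
- by rewrite hl gl.
- exact: bij_comp.
- by rewrite gq hq.
- by rewrite gs hs.
Qed.

Lemma Inv_inverse g : Inv g -> exists2 h, Inv h & cancel g h /\ cancel h g.
Proof.
move=> [gl [h gK hK] gq gs]; exists h => //; split=> [k X Y||X|X Y].
- by apply: (can_inj gK); rewrite gl !hK.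
- by exists g.
- by rewrite -gq hK.
- by rewrite -gs !hK.
Qed.

End InvGroup.

(** * Smallest pivots and divisibility *)

Section Pivot.
Variables (T : Type) (R : T -> T -> Prop) (pivot : T -> int).
Hypothesis Rxx : forall x, R x x.
Hypothesis Rtrans : forall x y z, R x y -> R y z -> R x z.

(** The lower bound 0 allows the pivot 0 only if every pivot of the orbit is 0, so
    that divisibility by the pivot makes sense without a case distinction. *)
Definition pivot_min x := forall y, R x y -> pivot y <> 0 ->
  (0 < absz (pivot x) <= absz (pivot y))%N.

Lemma exists_pivot_min x : exists2 y, R x y & pivot_min y.
Proof.
have main n y : R x y -> (0 < absz (pivot y) <= n)%N ->
    exists2 z, R x z & pivot_min z.
  elim: n y => [|n IH] y Rxy; first by case: (absz _).
  move=> /andP[p0 pn]; have [[z [Ryz z0 zlt]] | no] := classic (exists z,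
    [/\ R y z, pivot z <> 0 & (absz (pivot z) < absz (pivot y))%N]).
    by apply: (IH z); [exact: Rtrans Rxy Ryz | lia].
  exists y => // z Ryz z0; rewrite p0 leqNgt; apply/negP => lt.
  by apply: no; exists z.
have [[y [Rxy y0]] | no] := classic (exists y, R x y /\ pivot y <> 0).
  by apply: (main (absz (pivot y)) y) => //; lia.
by exists x => // y Rxy y0; case: no; exists y.
Qed.

Lemma pivot_min_trans x y :
  pivot_min x -> R x y -> pivot y = pivot x -> pivot_min y.
Proof. by move=> mx Rxy e z Ryz; rewrite e; apply: mx; apply: Rtrans Ryz. Qed.

(** Otherwise the Euclidean algorithm, carried out by the two moves, would
    produce a smaller nonzero pivot. *)
Lemma pivot_min_dvd (r : T -> int) x :
    (forall y t, exists2 z, R y z & pivot z = pivot y + t * r y) ->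
    (forall y t, exists2 z, R y z & pivot z = pivot y /\ r z = r y + t * pivot y) ->
  pivot_min x -> (pivot x %| r x)%Z.
Proof.
move=> m1 m2 mx; have [p0 | pN0] := eqVneq (pivot x) 0.
  have [z Rxz zE] := m1 x 1; rewrite p0 dvd0z; apply/eqP.
  by apply: NNPP => r0; have := mx z Rxz; rewrite zE p0; lia.
have [z Rxz [zp zr]] := m2 x (- (r x %/ pivot x)%Z).
have := divz_eq (r x) (pivot x); have := modz_ge0 (r x) pN0.
have := ltz_mod (r x) pN0 => lt ge eq.
apply/dvdz_mod0P; apply: NNPP => s0; set s := (r x %% pivot x)%Z in lt ge eq s0.
have {}zr : r z = s by rewrite zr; lia.
have [w Rzw wp] := m1 z (- ((pivot x - 1) %/ s)%Z).
have sN0 : s != 0 by apply/eqP.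
have := divz_eq (pivot x - 1) s; have := modz_ge0 (pivot x - 1) sN0.
have := ltz_mod (pivot x - 1) sN0.
have := mx w (Rtrans Rxz Rzw); rewrite wp zp zr; lia.
Qed.

End Pivot.

Section Arithmetic.

Lemma dvdz_factor (d n : int) : (d %| n)%Z -> exists k, n = d * k.
Proof. by case/dvdzP => k ->; exists k; rewrite mulrC. Qed.

Lemma prime_dvdzM (p : nat) (m n : int) :
  prime p -> (p%:Z %| m * n)%Z = (p%:Z %| m)%Z || (p%:Z %| n)%Z.
Proof. by move=> pp; rewrite !dvdzE abszM Euclid_dvdM. Qed.

(** The cofactors are coprime also when a = b = 0. *)
Lemma bezout_factor (a b : int) : exists g a' b' u v,
  [/\ a = g * a', b = g * b' & u * a' + v * b' = 1].
Proof.
have [->|a0] := eqVneq a 0.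
  by exists b, 0, 1, 0, 1; split; ring.
have [u [v e]] := Bezoutz a b.
have /dvdz_factor[a' ea] := dvdz_gcdl a b; have /dvdz_factor[b' eb] := dvdz_gcdr a b.
have g0 : gcdz a b != 0 by rewrite gcdz_eq0 (negPf a0).
move: (gcdz a b) e ea eb g0 => g e ea eb g0.
exists g, a', b', u, v; split=> //; apply: (mulfI g0).
by rewrite mulr1 -[in RHS]e ea eb; ring.
Qed.

Lemma no_prime_factor (a : int) :
  (forall p : nat, prime p -> ~ (p%:Z %| a)%Z) -> a = 1 \/ a = -1.
Proof.
move=> h; suff: absz a = 1%N by lia.
have [//|n1] := eqVneq (absz a) 1%N.
have [a0|a0] := eqVneq (absz a) 0%N.
  by case: (h 2 isT); rewrite dvdzE a0.
by case: (h (pdiv (absz a)) (pdiv_prime _)); rewrite ?dvdzE ?pdiv_dvd //; lia.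
Qed.

Lemma bezout_coprime (a b : int) :
  (forall p : nat, prime p -> (p%:Z %| a)%Z -> ~ (p%:Z %| b)%Z) ->
  exists u v, u * a + v * b = 1.
Proof.
move=> h; have [g [a' [b' [u [v [ea eb e]]]]]] := bezout_factor a b.
have g1 : g * g = 1.
  have [p pp pg|->|->//] := no_prime_factor (a := g); last by [].
  by apply: (h p pp); rewrite ?ea ?eb dvdz_mulr.
exists (u * g), (v * g); rewrite ea eb.
by transitivity ((g * g) * (u * a' + v * b')); [ring | rewrite g1 e].
Qed.

(** Take for t the product of the primes that divide d but not a. *)
Lemma coprime_shift (a b d : int) : d <> 0 ->
    (forall p : nat, prime p -> (p%:Z %| a)%Z -> (p%:Z %| b)%Z -> ~ (p%:Z %| d)%Z) ->
  exists t, forall p : nat, prime p -> (p%:Z %| a + t * b)%Z -> ~ (p%:Z %| d)%Z.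
Proof.
move=> d0 h; pose s := [seq q <- primes (absz d) | ~~ (q %| absz a)%N].
exists (\prod_(q <- s) q)%:Z => p pp.
have sP : (p %| \prod_(q <- s) q)%N = (p \in s).
  rewrite big_seq (big_morph _ (fun m n => Euclid_dvdM m n pp) (_ : _ = false)).
    rewrite -big_seq big_has; apply/hasP/idP => [[q qs pq] | ps]; last by exists p.
    move: (qs); rewrite mem_filter mem_primes => /and3P[_ qp _].
    by move: pq; rewrite dvdn_prime2 // => /eqP ->.
  by rewrite dvdn1; case: p pp => [|[]].
move=> pt pd; have [pa | pNa] := boolP (p%:Z %| a)%Z.
  move: pt; rewrite rpredDl // prime_dvdzM //.
  case/orP => [|pb]; last exact: h pb pd.
  by rewrite dvdzE /= sP mem_filter; move: pa; rewrite dvdzE /= => ->.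
have d1 : (0 < absz d)%N by lia.
case/negP: (pNa); rewrite -(rpredDr (x := (\prod_(q <- s) q)%:Z * b)) //.
rewrite dvdz_mulr // dvdzE /= sP mem_filter mem_primes pp d1 /=.
by move: pd pNa; rewrite !dvdzE /= => -> ->.
Qed.

End Arithmetic.

(** * Maximal elements *)

Lemma zero_or_one_mod4P n :
  zero_or_one_mod4 n <-> exists e k, (e = 0 \/ e = 1) /\ n = e + 4 * k.
Proof.
rewrite /zero_or_one_mod4; split=> [|[e [k [[->|->] ->]]]]; [|lia|lia].
by move=> [h|h]; [exists 0 | exists 1]; exists (n %/ 4)%Z; split; lia.
Qed.

Lemma zero_or_one_mod4_sqr s k : zero_or_one_mod4 (4 * k + s ^+ 2).
Proof.
have e : s = (s %% 2)%Z + 2 * (s %/ 2)%Z by lia.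
have [r | r] : (s %% 2)%Z = 0 \/ (s %% 2)%Z = 1 by lia.
  apply/zero_or_one_mod4P; exists 0, (k + (s %/ 2)%Z ^+ 2); split; first by left.
  by rewrite {1}e r; ring.
apply/zero_or_one_mod4P; exists 1, (k + (s %/ 2)%Z ^+ 2 + (s %/ 2)%Z).
by split; [right | rewrite {1}e r; ring].
Qed.

Section Maximality.
Local Open Scope comp_scope.
Variable C : comp_ring.
Implicit Types (A B : cubic C) (X Y : freudenthal C).

Lemma quartic_mod4 X : zero_or_one_mod4 (quartic X).
Proof.
case: X => [[[al be] A] B]; rewrite /quartic.
rewrite (_ : _ + _ = 4 * (al * cubic_norm A + be * cubic_norm B
  - cubic_trace (sharp A) (sharp B)) + (cubic_trace A B - al * be) ^+ 2); last ring.
exact: zero_or_one_mod4_sqr.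
Qed.

(** If D is the discriminant of a quadratic order that is not maximal at p, then
    D / p ^ 2 is again a discriminant; here this is required for all elements in the
    class of X modulo p. On (1, beta, diag (a, b, c), 0) it amounts to p dividing
    beta and two of a, b, c, but the formulation by the norm is visibly invariant
    under Inv. *)
Definition nonmaximal_at (p : int) X := forall Y,
  exists2 m, zero_or_one_mod4 m & quartic (X + Y *~ p) = p ^+ 2 * m.

Definition maximal X := forall p : nat, prime p -> ~ nonmaximal_at p X.

Lemma nonmaximal_at_Inv p g X : Inv g -> nonmaximal_at p X -> nonmaximal_at p (g X).
Proof.
move=> [gl [h gK hK] gq _] nX Y.
have [m m4 e] := nX (h Y); exists m; first exact: m4.
have -> : g X + Y *~ p = g (X + h Y *~ p) by rewrite ![_ + _ *~ p]addrC gl hK.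
rewrite gq; exact: e.
Qed.

Lemma maximal_Inv g X : Inv g -> maximal X -> maximal (g X).
Proof.
move=> gI mX p pp nX; have [h hI [gK _]] := Inv_inverse gI.
by apply: (mX p pp); rewrite -(gK X); apply: nonmaximal_at_Inv.
Qed.

(** A fundamental discriminant is not of the form p ^ 2 m with m = 0 or 1 mod 4;
    already X itself, without perturbation, is a witness. *)
Lemma fundamental_maximal X : fundamental_discriminant (quartic X) -> maximal X.
Proof.
move=> fX p pp nX; have [m m4] := nX 0; rewrite mul0rz addr0 => e.
have p2 : (2 <= p)%N by apply: prime_gt1.
move: fX; rewrite e; case=> [[sq n1] | [k [ek sq k4]]].
  by have := sq p; rewrite dvdz_mulr // => /(_ isT); lia.
have [p2' | pN2] := eqVneq p 2%N.
  have km : k = m by move: ek; rewrite p2'; lia.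
  by subst; case: m4; lia.
have : (p%:Z ^+ 2 %| k)%Z.
  have: coprimez (p%:Z ^+ 2) 4.
    rewrite coprimezE abszX (_ : `|4|%N = 2 ^ 2)%N // coprimeXl // coprimeXr //.
    by rewrite prime_coprime // dvdn_prime2.
  by move/Gauss_dvdzr => <-; rewrite -ek dvdz_mulr.
by move/sq; lia.
Qed.

Lemma cubic_mulrz a b c (x y z : C) (k : int) :
  ((a, b, c), (x, y, z)) *~ k =
  ((a * k, b * k, c * k), (x *~ k, y *~ k, z *~ k)) :> cubic C.
Proof. by rewrite !pair_mulrz /= !mulrzz. Qed.

Lemma freudenthal_mulrz al be A B (k : int) :
  (al, be, A, B) *~ k = (al * k, be * k, A *~ k, B *~ k) :> freudenthal C.
Proof. by rewrite !pair_mulrz /= !mulrzz. Qed.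

Lemma cubic_norm_mulrz A (k : int) : cubic_norm (A *~ k) = k ^+ 3 * cubic_norm A.
Proof.
case: A => [[[a b] c] [[x y] z]].
rewrite cubic_mulrz !cubic_normE !cr_linE !cr_tracez; ring.
Qed.

Lemma sharp_mulrz A (k : int) : sharp (A *~ k) = sharp A *~ k ^+ 2.
Proof.
case: A => [[[a b] c] [[x y] z]].
rewrite cubic_mulrz !sharpE cubic_mulrz !cr_linE -!mulrzA.
congr (_, _, _, (_, _, _)); try ring;
  by rewrite mulrzBl -!mulrzA; congr (_ *~ _ - _ *~ _); ring.
Qed.

Lemma cubic_trace_mulrzr A B (k : int) :
  cubic_trace A (B *~ k) = k * cubic_trace A B.
Proof.
case: A B => [[[a b] c] [[x y] z]] [[[a' b'] c'] [[x' y'] z']].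
rewrite cubic_mulrz /cubic_trace !norm2zr; ring.
Qed.

Lemma cubic_trace_mulrzl A B (k : int) :
  cubic_trace (A *~ k) B = k * cubic_trace A B.
Proof. by rewrite cubic_traceC cubic_trace_mulrzr cubic_traceC. Qed.

Lemma cdiagE a b c : cdiag C a b c = ((a, b, c), (0, 0, 0)). Proof. by []. Qed.

Lemma diag_norm a b c : cubic_norm (cdiag C a b c) = a * b * c.
Proof. by rewrite cubic_normE !cr_norm0 !cr_mul0l cr_trace0; ring. Qed.

(** Reduction modulo p sends these to multiples of a single vector of the
    minimal orbit. *)
Lemma nonmaximal_rank1 (p al be : int) A :
  nonmaximal_at p (al * p, be, A *~ p, 0 : cubic C).
Proof.
case=> [[[al' be'] A'] B']; rewrite freudenthal_mulrz freudenthalDE add0r.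
rewrite -mulrDl -mulrzDl; move: (al + al') (A + A') (be + be' * p) => {}al {}A {}be.
exists (4 * (p * al * p * cubic_norm A + be * p * cubic_norm B'
             - p ^+ 2 * cubic_trace (sharp A) (sharp B'))
        + (p * cubic_trace A B' - al * be) ^+ 2); first exact: zero_or_one_mod4_sqr.
rewrite /quartic !sharp_mulrz !cubic_norm_mulrz.
rewrite !(cubic_trace_mulrzl, cubic_trace_mulrzr); ring.
Qed.

(** Reduction modulo p gives (al, 0, diag (0, 0, c), 0). *)
Lemma nonmaximal_rank2 (p al be a b c : int) :
  nonmaximal_at p (diag_elt C al (be * p) (a * p) (b * p) c).
Proof.
case=> [[[al' be'] [[[a' b'] c'] [[x y] z]]] B'].
rewrite /diag_elt cdiagE freudenthal_mulrz cubic_mulrz freudenthalDE cubicDE !add0r.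
rewrite -!mulrDl; move: (al + _) (be + _) (a + _) (b + _) (c + _) => {}al {}be {}a {}b {}c.
pose A : cubic C := ((a * p, b * p, c), (x *~ p, y *~ p, z *~ p)).
pose N := a * b * c - a * p * cr_norm x - b * p * cr_norm y - c * cr_norm z
          + p * cr_trace ((x ∘ y) ∘ z).
have NE : cubic_norm A = p ^+ 2 * N.
  by rewrite /A cubic_normE !cr_linE !cr_tracez /N; ring.
rewrite -/A; exists (4 * (al * N + be * p ^+ 2 * cubic_norm B'
    - cubic_trace (sharp A) (sharp B')) + (cubic_trace A B' - al * be) ^+ 2).
  exact: zero_or_one_mod4_sqr.
rewrite /quartic !sharp_mulrz !cubic_norm_mulrz NE.
rewrite !(cubic_trace_mulrzl, cubic_trace_mulrzr); ring.
Qed.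

Definition normal_form (n : int) : freudenthal C :=
  diag_elt C 1 (n %% 4)%Z (n %/ 4)%Z 1 1.

Lemma diag_quartic al be a b c :
  quartic (diag_elt C al be a b c) = 4 * al * (a * b * c) + (al * be) ^+ 2.
Proof.
have z0 : cubic_norm (0 : cubic C) = 0.
  by rewrite -[0 in LHS](mulr0z (0 : cubic C)) cubic_norm_mulrz; ring.
have s0 : sharp (0 : cubic C) = 0.
  by rewrite -[0 in LHS](mulr0z (0 : cubic C)) sharp_mulrz mulr0z.
have t0 A : cubic_trace A (0 : cubic C) = 0.
  by rewrite -[0 in LHS](mulr0z (0 : cubic C)) cubic_trace_mulrzr mul0r.
rewrite /quartic /diag_elt z0 s0 !t0 diag_norm; ring.
Qed.

Lemma quartic_normal_form n : zero_or_one_mod4 n -> quartic (normal_form n) = n.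
Proof. by rewrite diag_quartic; case; lia. Qed.

(** No prime divides beta and two of the diagonal entries: the gcd conditions of a
    projective diagonal element with alpha = 1. *)
Definition unramified (be a b c : int) := forall p : nat, prime p ->
  (p%:Z %| be)%Z ->
  [/\ ~ ((p%:Z %| a)%Z /\ (p%:Z %| b)%Z), ~ ((p%:Z %| b)%Z /\ (p%:Z %| c)%Z)
    & ~ ((p%:Z %| c)%Z /\ (p%:Z %| a)%Z)].

(** If p divides beta, then adding p to a changes the norm by 4 p b c, which is not
    divisible by p ^ 2 if p is odd; for p = 2 it is 8 modulo 16, which changes the
    quotient of the norm by 4 by 2 modulo 4. Otherwise adding p to beta changes the
    norm by 2 p beta + p ^ 2, not divisible by p ^ 2 if p is odd; for p = 2 the norm
    is odd. *)
Lemma not_nonmaximal_diag (p : nat) (be a b c : int) : prime p ->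
    ((p%:Z %| be)%Z -> ~~ (p%:Z %| b * c)%Z) ->
  ~ nonmaximal_at p (diag_elt C 1 be a b c).
Proof.
move=> pp pbe nX; have p1 := prime_gt1 pp.
have diagD be' a' : diag_elt C 1 be a b c + diag_elt C 0 be' a' 0 0 *~ p
    = diag_elt C 1 (be + be' * p) (a + a' * p) b c.
  rewrite /diag_elt !cdiagE freudenthal_mulrz cubic_mulrz mul0rz freudenthalDE.
  by rewrite cubicDE !mul0rz !mul0r !addr0.
have [m m4 e] := nX (diag_elt C 0 0 0 0 0).
have [m' _ e'] := nX (diag_elt C 0 1 0 0 0).
have [m2 m24 e2] := nX (diag_elt C 0 0 1 0 0).
rewrite diagD diag_quartic in e; rewrite diagD diag_quartic in e'.
rewrite diagD diag_quartic in e2.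
have pN0 : p%:Z != 0 by lia.
have p_eq2 : (p%:Z %| 2)%Z -> p = 2%N.
  by rewrite dvdzE /= dvdn_prime2 // => /eqP.
have [pb | pNb] := boolP (p%:Z %| be)%Z.
  have h : 4 * (b * c) = p%:Z * (m2 - m).
    by apply: (mulfI pN0); rewrite [RHS]mulrA -expr2 mulrBr -e -e2; ring.
  have : (p%:Z %| 2 * (2 * (b * c)))%Z by rewrite mulrA h dvdz_mulr.
  have pbc := pbe pb; rewrite !prime_dvdzM // -prime_dvdzM // (negPf pbc) orbF orbb.
  move/p_eq2 => pE; move: pbc h m4 m24; rewrite pE.
  by move: (b * c) => d; rewrite /zero_or_one_mod4; lia.
have h : 2 * be = p%:Z * (m' - m - 1).
  by apply: (mulfI pN0); rewrite [RHS]mulrA -expr2 !mulrBr -e -e'; ring.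
have : (p%:Z %| 2 * be)%Z by rewrite h dvdz_mulr.
rewrite prime_dvdzM // (negPf pNb) orbF => /p_eq2 pE.
case/negP: pNb; suff: (p%:Z %| be * be)%Z by rewrite prime_dvdzM // orbb.
move: e; rewrite pE; move: (b * c) => d.
rewrite !mul0r !addr0 !mul1r !mulr1 expr2; move: (be * be) => s.
move=> es; have -> : s = 2 * (2 * m - 2 * (a * b * c)) by lia.
by rewrite dvdz_mulr.
Qed.

Lemma unramified_maximal be a b c :
  unramified be a b c -> maximal (diag_elt C 1 be a b c).
Proof.
move=> h p pp.
have rot be1 a1 b1 c1 : nonmaximal_at p (diag_elt C 1 be1 a1 b1 c1) ->
    nonmaximal_at p (diag_elt C 1 be1 b1 c1 a1).
  exact: nonmaximal_at_Inv (@rotation_Inv C).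
have main be1 a1 b1 c1 := @not_nonmaximal_diag p be1 a1 b1 c1 pp.
have [pb | pNb] := boolP (p%:Z %| be)%Z; last first.
  by apply: main => pb; rewrite pb in pNb.
have [hab hbc hca] := h p pp pb.
have [pa | pNa] := boolP (p%:Z %| a)%Z.
  apply: main => _; rewrite prime_dvdzM //; apply/norP.
  by split; apply/negP => ?; [apply: hab | apply: hca].
have [pb' | pNb'] := boolP (p%:Z %| b)%Z.
  move/rot; apply: main => _; rewrite prime_dvdzM // (negPf pNa) orbF.
  by apply/negP => ?; apply: hbc.
move/rot/rot; apply: main => _; rewrite prime_dvdzM // (negPf pNa).
exact: pNb'.
Qed.

(** Since alpha divides all coordinates, the gcd conditions force alpha = 1. *)
Lemma projective_maximal X : projective X -> maximal X.
Proof.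
move=> [g gI [al [be [a [b [c [gX [al0 /dvdz_factor[be' beE] /dvdz_factor[a' aE]]]]]]]]].
move=> /dvdz_factor[b' bE] /dvdz_factor[c' cE] [g1 g2 g3].
have [h hI [gK hK]] := Inv_inverse gI; rewrite -(gK X).
apply: maximal_Inv => //; rewrite gX.
have dvd1 (p x y z : int) : gcd3 x y z = 1 -> (p %| x)%Z -> (p %| y)%Z -> (p %| z)%Z ->
    absz p = 1%N.
  move=> e px py pz; have : (p %| gcd3 x y z)%Z by rewrite /gcd3 !dvdz_gcd px py.
  by rewrite e dvdz1 => /eqP.
have al1 : al = 1.
  suff: absz al = 1%N by lia.
  by apply: (dvd1 _ _ _ _ g1); rewrite ?dvdz_mulr // ?bE -?mulrA dvdz_mulr.
rewrite al1; apply: unramified_maximal => p pp pbe.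
have pN1 : absz p%:Z <> 1%N by move/eqP; rewrite /= gtn_eqF ?prime_gt1.
rewrite al1 !mul1r in g1 g2 g3.
split=> -[px py]; apply: pN1.
- by apply: (dvd1 _ _ _ _ g1) => //; rewrite dvdz_mulr.
- by apply: (dvd1 _ _ _ _ g2) => //; rewrite dvdz_mull.
- by apply: (dvd1 _ _ _ _ g3) => //; rewrite dvdz_mulr.
Qed.

Lemma projective_normal_form n : projective (normal_form n).
Proof.
exists id; first exact: Inv_id.
exists 1, (n %% 4)%Z, (n %/ 4)%Z, 1, 1; split=> //.
by split; rewrite /gcd3 !mul1r ?mulr1 ?gcdz1 ?gcd1z.
Qed.

End Maximality.

(** * Reduction to the normal form *)

(** What the reduction needs of the composition ring. All three rings are split:
    their coordinates are pairings with isotropic vectors u, for which a shear has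
    no quadratic term; the partner w with (w, u) = 1 makes the Euclidean algorithm
    on such a coordinate possible. *)
Record split_composition (C : comp_ring) : Prop := SplitComposition {
  split_normM : forall x y : C, cr_norm (cr_mul x y) = cr_norm x * cr_norm y;
  split_dvd : forall (d : int) (z : C),
    (forall u w, cr_norm u = 0 -> norm2 w u = 1 -> (d %| norm2 z u)%Z) ->
    exists z', z = z' *~ d;
  split_pair : exists u w : C,
    [/\ cr_norm u = 0, cr_norm w = 0 & norm2 w u = 1]
}.

Section CubicReduction.
Local Open Scope comp_scope.
Variables (C : comp_ring) (M : cubic C -> cubic C -> Prop).
Hypothesis splitC : split_composition C.
Hypothesis Mxx : forall A, M A A.
Hypothesis Mtrans : forall A1 A2 A3, M A1 A2 -> M A2 A3 -> M A1 A3.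
Hypothesis M_upper : forall u A, M A (upper_shear u A).
Hypothesis M_lower : forall u A, M A (lower_shear u A).
Hypothesis M_rot : forall A, M A (rot3 A).
Implicit Types (A B : cubic C) (u w : C) (t : int).

Let M_rot2 A A' : M (rot3 A) A' -> M A (rot3 (rot3 A')).
Proof.
by move=> h; apply: Mtrans (M_rot A) _; apply: Mtrans h _; apply: Mtrans (M_rot _).
Qed.

Let M_rot1 A A' : M (rot3 (rot3 A)) A' -> M A (rot3 A').
Proof.
move=> h; apply: Mtrans (M_rot A) _; apply: Mtrans (M_rot _) _.
exact: Mtrans h _.
Qed.

Let shear12 a b c (x y z : C) u : M ((a, b, c), (x, y, z))
  ((a + norm2 z u + cr_norm u * b, b, c), (x, y + x^† ∘ u^†, z + u *~ b)).
Proof. exact: M_upper u _. Qed.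

Let shear21 a b c (x y z : C) u : M ((a, b, c), (x, y, z))
  ((a, b + norm2 z u + cr_norm u * a, c), (x + u^† ∘ y^†, y, z + u *~ a)).
Proof. exact: M_lower u _. Qed.

Let shear23 a b c (x y z : C) u : M ((a, b, c), (x, y, z))
  ((a, b + norm2 x u + cr_norm u * c, c), (x + u *~ c, y, z + y^† ∘ u^†)).
Proof. exact: M_rot2 (M_upper u _). Qed.

Let shear32 a b c (x y z : C) u : M ((a, b, c), (x, y, z))
  ((a, b, c + norm2 x u + cr_norm u * b), (x + u *~ b, y + u^† ∘ z^†, z)).
Proof. exact: M_rot2 (M_lower u _). Qed.

Let shear31 a b c (x y z : C) u : M ((a, b, c), (x, y, z))
  ((a, b, c + norm2 y u + cr_norm u * a), (x + z^† ∘ u^†, y + u *~ a, z)).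
Proof. exact: M_rot1 (M_upper u _). Qed.

Let shear13 a b c (x y z : C) u : M ((a, b, c), (x, y, z))
  ((a + norm2 y u + cr_norm u * c, b, c), (x, y + u *~ c, z + u^† ∘ x^†)).
Proof. exact: M_rot1 (M_lower u _). Qed.

Let head A : int := A.1.1.1.

(** A smallest nonzero first diagonal entry divides the entries next to it, so
    that these can be cleared. *)
Lemma clear_first_row A : exists a b c x, M A ((a, b, c), (x, 0, 0)).
Proof.
have [[[[a b] c] [[x y] z]] MA mA] := exists_pivot_min head Mxx Mtrans A.
have [z' zE] : exists z', z = z' *~ a.
  apply: (split_dvd splitC) => u w u0 wu.
  apply: (pivot_min_dvd (r := fun B : cubic C => norm2 B.2.2 u) Mtrans _ _ mA).
    move=> [[[a1 b1] c1] [[x1 y1] z1]] t; eexists; first exact: (shear12 _ _ _ _ _ _ (u *~ t)).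
    by rewrite /head /= norm2zr cr_normz u0; ring.
  move=> [[[a1 b1] c1] [[x1 y1] z1]] t; eexists; first exact: (shear21 _ _ _ _ _ _ (w *~ t)).
  by rewrite /head /= norm2Dl !norm2zl wu; split; ring.
have [y' yE] : exists y', y = y' *~ a.
  apply: (split_dvd splitC) => u w u0 wu.
  apply: (pivot_min_dvd (r := fun B : cubic C => norm2 B.2.1.2 u) Mtrans _ _ mA).
    move=> [[[a1 b1] c1] [[x1 y1] z1]] t; eexists; first exact: (shear13 _ _ _ _ _ _ (u *~ t)).
    by rewrite /head /= norm2zr cr_normz u0; ring.
  move=> [[[a1 b1] c1] [[x1 y1] z1]] t; eexists; first exact: (shear31 _ _ _ _ _ _ (w *~ t)).
  by rewrite /head /= norm2Dl !norm2zl wu; split; ring.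
have Mz := shear21 a b c x y z (- z').
rewrite [in X in M _ X]zE -mulrzDl subrr mul0rz in Mz.
move: Mz; set b1 := b + _ + _; set x1 := x + _ => Mz.
have My := shear31 a b1 c x1 y 0 (- y').
rewrite [in X in M _ X]yE -mulrzDl subrr mul0rz cr_conj0 cr_mul0l addr0 in My.
by do 4 eexists; apply: Mtrans MA _; apply: Mtrans Mz _; exact: My.
Qed.

Lemma diagonalize A : exists a b c, M A (cdiag C a b c).
Proof.
have [a [b [c [x MA]]]] := clear_first_row A.
pose emb (q : int * int * C) : cubic C := ((a, q.1.1, q.1.2), (q.2, 0, 0)).
pose M2 q q' := M (emb q) (emb q').
have M2xx q : M2 q q by apply: Mxx.
have M2trans q q' q'' : M2 q q' -> M2 q' q'' -> M2 q q'' by apply: Mtrans.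
have M2_23 b1 c1 x1 u : M2 (b1, c1, x1) (b1 + norm2 x1 u + cr_norm u * c1, c1, x1 + u *~ c1).
  by have := shear23 a b1 c1 x1 0 0 u; rewrite cr_conj0 cr_mul0l addr0.
have M2_32 b1 c1 x1 u : M2 (b1, c1, x1) (b1, c1 + norm2 x1 u + cr_norm u * b1, x1 + u *~ b1).
  by have := shear32 a b1 c1 x1 0 0 u; rewrite cr_conj0 cr_mul0r addr0.
have [[[b1 c1] x1] Mb mb] :=
  exists_pivot_min (fun q : int * int * C => q.1.1) M2xx M2trans (b, c, x).
have [x' xE] : exists x', x1 = x' *~ b1.
  apply: (split_dvd splitC) => u w u0 wu.
  apply: (pivot_min_dvd (r := fun q : int * int * C => norm2 q.2 u) M2trans _ _ mb).
    move=> [[b2 c2] x2] t; eexists; first exact: (M2_23 _ _ _ (u *~ t)).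
    by rewrite /= norm2zr cr_normz u0; ring.
  move=> [[b2 c2] x2] t; eexists; first exact: (M2_32 _ _ _ (w *~ t)).
  by rewrite /= norm2Dl !norm2zl wu; split; ring.
have Mx := M2_32 b1 c1 x1 (- x').
rewrite [in X in M2 _ X]xE -mulrzDl subrr mul0rz in Mx.
by do 3 eexists; apply: Mtrans MA _; apply: Mtrans Mb _; exact: Mx.
Qed.

(** The 2 x 2 Smith normal form, inside the matrices with entries in Z u + Z w
    for an isotropic pair (u, w). *)
Lemma diag_gcd g a b c s t : s * a + t * b = 1 ->
  M (cdiag C (g * a) (g * b) c) (cdiag C g (g * a * b) c).
Proof.
move=> e; have [u [w [u0 w0 wu]]] := split_pair splitC.
have up a1 b1 c1 z v : M ((a1, b1, c1), (0, 0, z))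
    ((a1 + norm2 z v + cr_norm v * b1, b1, c1), (0, 0, z + v *~ b1)).
  by have := shear12 a1 b1 c1 0 0 z v; rewrite cr_conj0 cr_mul0l addr0.
have lo a1 b1 c1 z v : M ((a1, b1, c1), (0, 0, z))
    ((a1, b1 + norm2 z v + cr_norm v * a1, c1), (0, 0, z + v *~ a1)).
  by have := shear21 a1 b1 c1 0 0 z v; rewrite cr_conj0 cr_mul0r addr0.
have uu : norm2 u u = 0 by rewrite norm2xx u0.
have ww : norm2 w w = 0 by rewrite norm2xx w0.
have uw : norm2 u w = 1 by rewrite norm2C.
pose E a1 b1 p q : cubic C := ((a1, b1, c), (0, 0, w *~ p + u *~ q)).
have E0 a1 b1 : E a1 b1 0 0 = cdiag C a1 b1 c by rewrite /E !mulr0z addr0.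
have Ew p q k r : w *~ p + u *~ q + w *~ k *~ r = w *~ (p + k * r) + u *~ q.
  by rewrite -mulrzA mulrzDr addrAC.
have Eu p q k r : w *~ p + u *~ q + u *~ k *~ r = w *~ p + u *~ (q + k * r).
  by rewrite -mulrzA mulrzDr addrA.
have up_w k a1 b1 p q : M (E a1 b1 p q) (E (a1 + k * q) b1 (p + k * b1) q).
  have := up a1 b1 c (w *~ p + u *~ q) (w *~ k); rewrite Ew.
  rewrite norm2Dl !(norm2zl, norm2zr) cr_normz w0 ww uw.
  by rewrite !mulr0 mul0r mulr1 !addr0 add0r [_ * k]mulrC.
have up_u k a1 b1 p q : M (E a1 b1 p q) (E (a1 + k * p) b1 p (q + k * b1)).
  have := up a1 b1 c (w *~ p + u *~ q) (u *~ k); rewrite Eu.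
  rewrite norm2Dl !(norm2zl, norm2zr) cr_normz u0 uu wu.
  by rewrite !mulr0 mul0r mulr1 !addr0 [_ * k]mulrC.
have lo_w k a1 b1 p q : M (E a1 b1 p q) (E a1 (b1 + k * q) (p + k * a1) q).
  have := lo a1 b1 c (w *~ p + u *~ q) (w *~ k); rewrite Ew.
  rewrite norm2Dl !(norm2zl, norm2zr) cr_normz w0 ww uw.
  by rewrite !mulr0 mul0r mulr1 !addr0 add0r [_ * k]mulrC.
have lo_u k a1 b1 p q : M (E a1 b1 p q) (E a1 (b1 + k * p) p (q + k * a1)).
  have := lo a1 b1 c (w *~ p + u *~ q) (u *~ k); rewrite Eu.
  rewrite norm2Dl !(norm2zl, norm2zr) cr_normz u0 uu wu.
  by rewrite !mulr0 mul0r mulr1 !addr0 [_ * k]mulrC.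
(* In 2 x 2 matrices: [g a, 0; 0, g b] ~> [g a, g; 0, g b], then the entry g
   clears the others. *)
rewrite -!E0; apply: Mtrans (up_w t _ _ _ _) _; apply: Mtrans (lo_w s _ _ _ _) _.
have -> : 0 + t * (g * b) + s * (g * a + t * 0) = g.
  by transitivity (g * (s * a + t * b)); [ring | rewrite e mulr1].
apply: Mtrans (up_u (1 - a) _ _ _ _) _; apply: Mtrans (lo_u (- ((1 - a) * b)) _ _ _ _) _.
apply: Mtrans (lo_w (-1) _ _ _ _) _.
set Z := (X in M X _); suff -> : Z = E g (g * a * b) 0 0 by apply: Mxx.
by rewrite /Z; congr E; ring.
Qed.

End CubicReduction.

Section Reduction.
Variables (C : comp_ring) (R : freudenthal C -> freudenthal C -> Prop).
Hypothesis splitC : split_composition C.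
Hypothesis Rxx : forall X, R X X.
Hypothesis Rtrans : forall X Y Z, R X Y -> R Y Z -> R X Z.
Hypothesis R_translation : forall t X, R X (translation t X).
Hypothesis R_duality : forall X, R X (duality X).
Hypothesis R_rotation : forall X, R X (rotation X).
Hypothesis R_shear : forall u X, R X (shear u X).
Implicit Types (A B : cubic C) (X Y : freudenthal C) (u w : C) (t : int).

Let R_dual_inv al be A B : R (al, be, A, B) (be, - al, B, - A).
Proof.
have := Rtrans (R_duality (al, be, A, B)) (R_duality _).
move/Rtrans/(_ (R_duality _)); rewrite /duality !opprK; exact.
Qed.

Lemma upper_shearN u A : upper_shear u (- A) = - upper_shear u A.
Proof.
case: A => [[[a b] c] [[x y] z]]; rewrite cubicN /upper_shear cubicN !cr_linE.
by rewrite mulrNz !opprD mulrN.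
Qed.

Lemma upper_shear0 u : upper_shear u 0 = 0.
Proof.
rewrite -[0]/((0, 0, 0), (0, 0, 0)) /upper_shear norm02 cr_conj0 cr_mul0l.
by rewrite mulr0z mulr0 !addr0.
Qed.

Lemma lower_shear0 u : lower_shear u 0 = 0.
Proof.
rewrite -[0]/((0, 0, 0), (0, 0, 0)) /lower_shear norm02 cr_conj0 cr_mul0r.
by rewrite mulr0z mulr0 !addr0.
Qed.

Let R_coshear u al be A B :
  R (al, be, A, B) (al, be, lower_shear u A, upper_shear (- u) B).
Proof.
apply: Rtrans (R_duality _) _; apply: Rtrans (R_shear (- u) _) _.
rewrite /duality /shear opprK upper_shearN.
by have := R_dual_inv (- be) al (- upper_shear (- u) B) (lower_shear u A); rewrite !opprK.
Qed.

Let R_cotranslation t al be a b c (x y z : C) a' b' c' (x' y' z' : C) :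
  R (al, be, ((a, b, c), (x, y, z)), ((a', b', c'), (x', y', z')))
    (al, be + t * a, ((a, b + t * c', c + t * b'), (x - x' *~ t, y, z)),
     ((a' + t * al, b', c'), (x', y', z'))).
Proof.
apply: Rtrans (R_duality _) _; apply: Rtrans (R_translation (- t) _) _.
rewrite /duality /translation !cubicN; apply: Rtrans (R_dual_inv _ _ _ _) _.
rewrite !cubicN; set Z := (Z in R Z _); set Y := (Y in R _ Y).
suff -> : Z = Y by apply: Rxx.
rewrite /Z /Y; congr (_, _, (_, _, _, (_, _, _)), (_, _, _, (_, _, _)));
  rewrite ?opprK ?opprB ?mulrNz ?mulNrz ?opprK //; try ring.
Qed.

Hypothesis R_Inv : forall X Y, R X Y -> exists2 g, Inv g & g X = Y.

Let maximal_R X Y : R X Y -> maximal X -> maximal Y.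
Proof. by move=> /R_Inv[g gI <-]; apply: maximal_Inv. Qed.

(** Diagonalizing B first reduces the divisibility of all coordinates of B by
    alpha to that of the first diagonal entry. *)
Let clear_fourth al be A B :
    (forall Z, R (al, be, A, B) Z -> Z.1.1.1 = al -> (al %| Z.2.1.1.1)%Z) ->
  exists be' A', R (al, be, A, B) (al, be', A', 0).
Proof.
move=> alB.
pose M B B' := forall be A, exists be' A', R (al, be, A, B) (al, be', A', B').
have Mxx B1 : M B1 B1 by move=> be1 A1; exists be1, A1.
have Mtrans B1 B2 B3 : M B1 B2 -> M B2 B3 -> M B1 B3.
  move=> h1 h2 be1 A1; have [be2 [A2 R12]] := h1 be1 A1.
  by have [be3 [A3 R23]] := h2 be2 A2; exists be3, A3; apply: Rtrans R23.
have M_up u B1 : M B1 (upper_shear u B1).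
  move=> be1 A1; exists be1, (lower_shear (- u) A1).
  by have := R_coshear (- u) al be1 A1 B1; rewrite opprK.
have M_lo u B1 : M B1 (lower_shear u B1).
  move=> be1 A1; exists be1, (upper_shear (- u) A1).
  by have := R_shear (- u) (al, be1, A1, B1); rewrite /shear opprK.
have M_rot B1 : M B1 (rot3 B1).
  by move=> be1 A1; exists be1, (rot3 A1); exact: R_rotation (al, be1, A1, B1).
have M_clear a b c k : a = al * k -> M (cdiag C a b c) (cdiag C 0 b c).
  move=> -> be1 [[[a1 b1] c1] [[x1 y1] z1]]; do 2 eexists.
  have := R_cotranslation (- k) al be1 a1 b1 c1 x1 y1 z1 (al * k) b c 0 0 0.
  by rewrite (_ : al * k + - k * al = 0); [exact | ring].
have [a [b [c MB]]] := diagonalize splitC Mxx Mtrans M_up M_lo M_rot B.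
have [be1 [A1 R1]] := MB be A.
have R2 := Rtrans R1 (R_rotation _); have R3 := Rtrans R2 (R_rotation _).
have /dvdz_factor[a' aE] := alB _ R1 erefl.
have /dvdz_factor[b' bE] := alB _ R2 erefl.
have /dvdz_factor[c' cE] := alB _ R3 erefl.
have M0 : M B (cdiag C 0 0 0).
  apply: (Mtrans _ _ _ MB); apply: (Mtrans _ _ _ (M_clear _ _ _ _ aE)).
  apply: (Mtrans _ _ _ (M_rot _)); apply: (Mtrans _ _ _ (M_clear _ _ _ _ bE)).
  apply: (Mtrans _ _ _ (M_rot _)); exact: (M_clear _ _ _ _ cE).
exact: M0 be A.
Qed.

(** The shears and the rotation fix B = 0 and act on A as a relation to which the
    cubic reduction applies. *)
Let R_third (P : (cubic C -> cubic C -> Prop) -> Prop) :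
    (forall M : cubic C -> cubic C -> Prop,
       (forall A, M A A) -> (forall A1 A2 A3, M A1 A2 -> M A2 A3 -> M A1 A3) ->
       (forall u A, M A (upper_shear u A)) -> (forall u A, M A (lower_shear u A)) ->
       (forall A, M A (rot3 A)) -> P M) ->
  forall al be, P (fun A A' => R (al, be, A, 0) (al, be, A', 0)).
Proof.
move=> PM al be; apply: PM => [A1|A1 A2 A3|u A1|u A1|A1].
- exact: Rxx.
- exact: Rtrans.
- by have := R_shear u (al, be, A1, 0); rewrite /shear lower_shear0.
- by have := R_coshear u al be A1 0; rewrite upper_shear0.
- exact: R_rotation (al, be, A1, 0).
Qed.

Let diagonalize_third al be A :
  exists a b c, R (al, be, A, 0) (al, be, cdiag C a b c, 0).
Proof.
move: al be; apply: (R_third (P := fun M => exists a b c, M A (cdiag C a b c))).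
by move=> M M1 M2 M3 M4 M5; exact: (diagonalize splitC M1 M2 M3 M4 M5 A).
Qed.

Let R_gcd be g a b c s t : s * a + t * b = 1 ->
  R (diag_elt C 1 be (g * a) (g * b) c) (diag_elt C 1 be g (g * a * b) c).
Proof.
move=> e; apply: (R_third (P := fun M =>
  M (cdiag C (g * a) (g * b) c) (cdiag C g (g * a * b) c))).
by move=> M M1 M2 M3 M4 _; exact: (diag_gcd splitC M1 M2 M3 M4 _ _ e).
Qed.

(** Among the nonzero values of the first coordinate on the orbit, take one of
    smallest absolute value. It divides B, and after clearing B and diagonalizing
    A it divides A, because a translation moves the entries of A into B. A prime
    factor of it would contradict maximality. *)
Lemma reduce_to_diag X : maximal X -> exists be a b c, R X (diag_elt C 1 be a b c).
Proof.
move=> mX; pose al0 X' := (X' : freudenthal C).1.1.1.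
have [[[[al be] A] B] RX minX] := exists_pivot_min al0 Rxx Rtrans X.
have alB Z : R (al, be, A, B) Z -> Z.1.1.1 = al -> (al %| Z.2.1.1.1)%Z.
  move=> RZ eZ; rewrite -eZ.
  apply: (pivot_min_dvd (r := fun Z' : freudenthal C => Z'.2.1.1.1) Rtrans _ _
    (pivot_min_trans Rtrans minX RZ eZ)).
  - move=> [[[al1 be1] [[[a b] c] [[x y] z]]] [[[a' b'] c'] [[x' y'] z']]] t.
    by eexists; first exact: (R_translation t).
  - move=> [[[al1 be1] [[[a b] c] [[x y] z]]] [[[a' b'] c'] [[x' y'] z']]] t.
    by eexists; first exact: (R_cotranslation t).
have [be1 [A1 R1]] := clear_fourth alB.
have [a [b [c R2]]] := diagonalize_third al be1 A1.
have {}R2 := Rtrans R1 R2.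
have al_dvd a1 b1 c1 : R (al, be, A, B) (al, be1, cdiag C a1 b1 c1, 0) -> (al %| c1)%Z.
  move=> R3; have {}R3 := Rtrans (Rtrans R3 (R_translation 1 _)) (R_rotation _).
  by have := alB _ R3; rewrite /= add0r !mul1r addr0 => /(_ erefl).
have R3 := Rtrans R2 (R_rotation _); have R4 := Rtrans R3 (R_rotation _).
have /dvdz_factor[c' cE] := al_dvd _ _ _ R2; have /dvdz_factor[a' aE] := al_dvd _ _ _ R3.
have /dvdz_factor[b' bE] := al_dvd _ _ _ R4.
have {}R2 := Rtrans RX R2; have mY := maximal_R R2 mX.
have [p pp /dvdz_factor[al' alE] | al1 | al1] := no_prime_factor (a := al).
- apply: (mY p pp).
  have := nonmaximal_rank1 p%:Z al' be1 (cdiag C (al' * a') (al' * b') (al' * c')).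
  rewrite aE bE cE alE !cdiagE cubic_mulrz !mul0rz.
  by rewrite -!(mulrA p%:Z) !(mulrC p%:Z).
- by exists be1, a, b, c; rewrite -al1.
- exists (- be1), (- a), (- b), (- c).
  apply: Rtrans R2 _; apply: Rtrans (R_duality _) _.
  have := R_duality (- be1, al, - 0, cdiag C a b c).
  by rewrite /diag_elt /duality al1 opprK !cdiagE !cubicN !oppr0.
Qed.

Let R_diag_rot al be a b c : R (diag_elt C al be a b c) (diag_elt C al be b c a).
Proof. exact: R_rotation (diag_elt C al be a b c). Qed.

Lemma maximal_unramified be a b c : maximal (diag_elt C 1 be a b c) -> unramified be a b c.
Proof.
have main be1 a1 b1 c1 (p : nat) : prime p -> (p%:Z %| be1)%Z ->
    maximal (diag_elt C 1 be1 a1 b1 c1) -> ~ ((p%:Z %| a1)%Z /\ (p%:Z %| b1)%Z).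
  move=> pp pbe mX [/dvdzP[a2 aE] /dvdzP[b2 bE]]; have /dvdzP[be2 beE] := pbe.
  by apply: (mX p pp); rewrite aE bE beE; exact: nonmaximal_rank2.
move=> m1 p pp pbe; have m2 := maximal_R (R_diag_rot _ _ _ _ _) m1.
have m3 := maximal_R (R_diag_rot _ _ _ _ _) m2.
by split; [apply: main m1 | apply: main m2 | apply: main m3].
Qed.

(** On the diagonal elements (2 x 2 x 2 cubes) the translation spoils B = 0; the two
    opposite translations at the other diagonal positions restore it. *)
Lemma diag_shift t be a b c :
  R (diag_elt C 1 be a b c)
    (diag_elt C 1 (be - 2 * t * b * c) (a + t * be - t ^+ 2 * b * c) b c).
Proof.
apply: Rtrans (R_translation t _) _; apply: Rtrans (R_rotation _) _.
rewrite /diag_elt /translation cdiagE /=.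
apply: Rtrans (R_cotranslation (- (t * c)) _ _ _ _ _ _ _ _ _ _ _ _ _ _) _.
apply: Rtrans (R_rotation _) _.
apply: Rtrans (R_cotranslation (- (t * b)) _ _ _ _ _ _ _ _ _ _ _ _ _ _) _.
apply: Rtrans (R_rotation _) _.
set Z := (Z in R Z _); set Y := (Y in R _ Y).
suff -> : Z = Y by apply: Rxx.
rewrite /Z /Y !mul0rz !subr0; congr (_, _, (_, _, _, _), _); try ring.
by rewrite -[RHS]/((0, 0, 0), (0, 0, 0)); congr (_, _, _, _); ring.
Qed.

Let unit_be be : (forall p : nat, prime p -> ~ (p%:Z %| be)%Z) -> be * be = 1.
Proof. by move/no_prime_factor => [] ->. Qed.

(** A shift makes the three entries coprime, because a common prime factor of b and
    c does not divide beta; if b = c = 0 then beta is a unit. *)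
Let diag_first1 be a b c : maximal (diag_elt C 1 be a b c) ->
  exists be' b' c', R (diag_elt C 1 be a b c) (diag_elt C 1 be' 1 b' c').
Proof.
move=> /maximal_unramified unr.
have [t tP] : exists t, forall p : nat, prime p ->
    (p%:Z %| a + t * be - t ^+ 2 * b * c)%Z -> (p%:Z %| b)%Z -> ~ (p%:Z %| c)%Z.
  have [/eqP | d0] := eqVneq (gcdz b c) 0.
    rewrite gcdz_eq0 => /andP[/eqP b0 /eqP c0]; exists (be * (1 - a)) => p pp.
    have be1 : be * be = 1.
      by apply: unit_be => q qp qbe; have [_ []] := unr q qp qbe; rewrite b0 c0 !dvdz0.
    rewrite b0 c0 !mulr0 subr0 mulrAC be1 mul1r addrC subrK => p1.
    by move: p1; rewrite dvdz1 /= gtn_eqF ?prime_gt1.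
  have [p pp pa pbe|t tP] := @coprime_shift a be (gcdz b c) (elimN eqP d0).
    rewrite dvdz_gcd => /andP[pb pc]; have [h _ _] := unr p pp pbe; exact: h.
  exists t => p pp pa pb pc; apply: (tP p pp); last by rewrite dvdz_gcd pb.
  by move: pa; rewrite rpredBr // dvdz_mull.
have [g [a' [b' [r [s [aE bE e]]]]]] := bezout_factor (a + t * be - t ^+ 2 * b * c) b.
have [p pp pc pg|u [v e2]] := @bezout_coprime c g.
  by apply: (tP p pp); rewrite // ?aE ?bE dvdz_mulr.
exists (be - 2 * t * b * c), (c * g), (g * a' * b').
apply: Rtrans (diag_shift t _ _ _ _) _; rewrite aE {2}bE.
apply: Rtrans (R_gcd _ _ _ e) _; do 2 apply: Rtrans (R_diag_rot _ _ _ _ _) _.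
by have := R_gcd (be - 2 * t * b * c) 1 (g * a' * b') e2; rewrite !mul1r.
Qed.

(** A shift makes b and c coprime; it acts on whichever of them leaves a nonzero
    one fixed, and if both vanish then beta is a unit. *)
Let diag_second1 be b c : maximal (diag_elt C 1 be 1 b c) ->
  exists be' k, R (diag_elt C 1 be 1 b c) (diag_elt C 1 be' k 1 1).
Proof.
move=> /maximal_unramified unr.
have hbc (p : nat) : prime p -> (p%:Z %| b)%Z -> (p%:Z %| be)%Z -> ~ (p%:Z %| c)%Z.
  by move=> pp pb pbe pc; have [_ h _] := unr p pp pbe; apply: h.
have fin be1 b1 c1 : (forall p : nat, prime p -> (p%:Z %| b1)%Z -> ~ (p%:Z %| c1)%Z) ->
    exists be' k, R (diag_elt C 1 be1 b1 c1 1) (diag_elt C 1 be' k 1 1).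
  move=> /bezout_coprime[u [v e]]; exists be1, (b1 * c1).
  have := R_gcd be1 1 1 e; rewrite !mul1r => h; apply: Rtrans h _.
  exact: R_diag_rot.
have [c0|cN0] := eqVneq c 0; last first.
  have [p pp pb pbe|t tP] := @coprime_shift b be c (elimN eqP cN0); first exact: hbc.
  have [p pp pb pc|be' [k h]] := fin (be - 2 * t * c * 1) (b + t * be - t ^+ 2 * c * 1) c.
    by apply: (tP p pp) => //; move: pb; rewrite mulr1 rpredBr // dvdz_mull.
  exists be', k; apply: Rtrans (R_diag_rot _ _ _ _ _) _.
  exact: Rtrans (diag_shift t _ _ _ _) h.
have [b0|bN0] := eqVneq b 0; last first.
  have [p pp pc pbe pb|t tP] := @coprime_shift c be b (elimN eqP bN0); first exact: (hbc p).
  have [p pp pb pc|be' [k h]] := fin (be - 2 * t * 1 * b) b (c + t * be - t ^+ 2 * 1 * b).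
    by apply: (tP p pp) => //; move: pc; rewrite rpredBr // dvdz_mull.
  exists be', k; do 2 apply: Rtrans (R_diag_rot _ _ _ _ _) _.
  apply: Rtrans (diag_shift t _ _ _ _) _.
  by do 2 apply: Rtrans (R_diag_rot _ _ _ _ _) _.
have be1 : be * be = 1.
  by apply: unit_be => p pp pbe; apply: (hbc p pp); rewrite ?b0 ?c0 ?dvdz0.
exists (be - 2 * be * c * 1), 0; apply: Rtrans (R_diag_rot _ _ _ _ _) _.
apply: Rtrans (diag_shift be _ _ _ _) _.
rewrite b0 c0 !mulr1 !mulr0 subr0 add0r be1; exact: R_diag_rot.
Qed.

(** The last shift brings beta into {0, 1}; the norm then determines the element. *)
Lemma reduce_to_normal_form X : maximal X -> R X (normal_form C (quartic X)).
Proof.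
move=> mX; have [be0 [a0 [b0 [c0 R0]]]] := reduce_to_diag mX.
have [be1 [b1 [c1 R1]]] := diag_first1 (maximal_R R0 mX).
have {}R1 := Rtrans R0 R1.
have [be2 [k2 R2]] := diag_second1 (maximal_R R1 mX).
have {}R2 := Rtrans (Rtrans R1 R2) (diag_shift (be2 %/ 2)%Z _ _ _ _).
set be := be2 - _ in R2; set k := k2 + _ - _ in R2.
have be01 : be = 0 \/ be = 1 by rewrite /be; lia.
have [g [_ _ gq _] gX] := R_Inv R2.
have := gq X; rewrite gX diag_quartic => <-.
have -> : 4 * 1 * (k * 1 * 1) + (1 * be) ^+ 2 = 4 * k + be by case: be01 => ->; ring.
rewrite /normal_form (_ : (_ %% 4)%Z = be) 1?(_ : (_ %/ 4)%Z = k) //; lia.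
Qed.

End Reduction.

(** * The three composition rings and the orbit classification *)

Lemma bin_split : split_composition bin_ring.
Proof.
split=> [[a b] [c d]|d [a b] dz|] /=; first by rewrite /=; ring.
  have := dz (1, 0) (0, 1) erefl erefl; have := dz (0, 1) (1, 0) erefl erefl.
  rewrite /norm2 /= => h1 h2; exists ((a %/ d)%Z, (b %/ d)%Z).
  rewrite pair_mulrz /= !mulrzz !divzK //.
    by move: h2; rewrite (_ : _ - _ = b) //; ring.
  by move: h1; rewrite (_ : _ - _ = a) //; ring.
by exists (1, 0), (0, 1); split.
Qed.

Lemma quat_norm2E (x y : quat_ring) : norm2 x y =
  x 0 0 * y 1 1 + x 1 1 * y 0 0 - x 0 1 * y 1 0 - x 1 0 * y 0 1.
Proof. rewrite /norm2 /= !(mx2_detE, mxE); ring. Qed.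

(** The matrix units are isotropic and their duals are again matrix units, up to
    sign. *)
Lemma mx2_dvd (d : int) (z : 'M[int]_2) :
    (forall u w : quat_ring, cr_norm u = 0 -> norm2 w u = 1 ->
       (d %| norm2 (z : quat_ring) u)%Z) ->
  exists z' : 'M[int]_2, z = z' *~ d.
Proof.
move=> dz; exists (\matrix_(i, j) (z i j %/ d)%Z).
apply: mx2P; rewrite mx2_mulrz mxE divzK //.
- have := dz (delta_mx 1 1) (delta_mx 0 0); rewrite !quat_norm2E /= mx2_detE !mxE /=.
  by rewrite !(mulr0, mulr1, mul0r, subr0, addr0, add0r); apply.
- have := dz (delta_mx 1 0) (- delta_mx 0 1); rewrite !quat_norm2E /= mx2_detE !mxE /=.
  rewrite !(mulr0, mulr1, mul0r, subr0, addr0, add0r, sub0r, oppr0) rpredN; exact.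
- have := dz (delta_mx 0 1) (- delta_mx 1 0); rewrite !quat_norm2E /= mx2_detE !mxE /=.
  rewrite !(mulr0, mulr1, mul0r, subr0, addr0, add0r, sub0r, oppr0) rpredN; exact.
- have := dz (delta_mx 0 0) (delta_mx 1 1); rewrite !quat_norm2E /= mx2_detE !mxE /=.
  by rewrite !(mulr0, mulr1, mul0r, subr0, addr0, add0r); apply.
Qed.

Lemma quat_pair : exists u w : quat_ring,
  [/\ cr_norm u = 0, cr_norm w = 0 & norm2 w u = 1].
Proof.
by exists (delta_mx 0 0), (delta_mx 1 1); rewrite quat_norm2E /= !mx2_detE !mxE.
Qed.

Lemma quat_split : split_composition quat_ring.
Proof.
split; [exact: det_mulmx | exact: mx2_dvd | exact: quat_pair].
Qed.

Lemma oct_norm2E (x y : oct_ring) :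
  norm2 x y = norm2 (x.1 : quat_ring) y.1 + norm2 (x.2 : quat_ring) y.2.
Proof. rewrite /norm2 /= /oct_norm /=; ring. Qed.

Lemma oct_split : split_composition oct_ring.
Proof.
split=> [[a b] [c d]|d [a b] dz|].
- rewrite /= /oct_norm /= !(mx2E, mxE) /= ?(mx2E, mxE) /=; ring.
- have [a' aE] : exists a' : 'M_2, a = a' *~ d.
    apply: mx2_dvd => u w u0 wu; have := dz (u, 0) (w, 0); rewrite !oct_norm2E /=.
    rewrite /oct_norm /= det0 addr0 !norm20 !addr0; exact.
  have [b' bE] : exists b' : 'M_2, b = b' *~ d.
    apply: mx2_dvd => u w u0 wu; have := dz (0, u) (0, w); rewrite !oct_norm2E /=.
    rewrite /oct_norm /= det0 add0r !norm20 !add0r; exact.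
  by exists (a', b'); rewrite pair_mulrz /= -aE -bE.
- have [u [w [u0 w0 wu]]] := quat_pair; exists (u, 0), (w, 0); rewrite oct_norm2E /=.
  by rewrite /oct_norm /= det0 !addr0 norm20 addr0.
Qed.

Definition classified_by_norm (P : action_pair) : Prop :=
  [/\ (forall g (x : ap_module P),
         ap_group g -> ap_norm (ap_act g x) = ap_norm x) /\
      (forall x : ap_module P, zero_or_one_mod4 (ap_norm x)),
      forall n : int, zero_or_one_mod4 n ->
        acts_transitively (fun x : ap_module P => ap_projective x /\ ap_norm x = n)
    & forall n : int, fundamental_discriminant n ->
        (forall x : ap_module P, ap_norm x = n -> ap_projective x) /\
        acts_transitively (fun x : ap_module P => ap_norm x = n)].

(** Projective elements and elements of fundamental norm are maximal, hence reduce
    to the normal form of their norm, which is projective. Maximality is invariant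
    under all of Inv, so that the acting group may be smaller than the group that
    defines projectivity. *)
Lemma normal_form_classifies (P : action_pair) (C : comp_ring)
    (e : ap_module P -> freudenthal C) (e' : freudenthal C -> ap_module P) :
    cancel e e' -> cancel e' e ->
    (forall x, ap_norm x = quartic (e x)) ->
    (forall x, ap_projective x <-> projective (e x)) ->
    (forall g, ap_group g -> exists2 h, Inv h & forall x, e (ap_act g x) = h (e x)) ->
    (forall g, ap_group g ->
       exists2 g' : ap_elt P, ap_group g' & forall x, ap_act g' (ap_act g x) = x) ->
    (forall g h, ap_group g -> ap_group h ->
       exists2 gh : ap_elt P, ap_group gh & forall x, ap_act gh x = ap_act g (ap_act h x)) ->
    (forall x, maximal (e x) -> exists2 g : ap_elt P, ap_group g &
       e (ap_act g x) = normal_form C (quartic (e x))) ->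
  classified_by_norm P.
Proof.
move=> eK e'K qE pE actI actV actM red.
have norm_act (g : ap_elt P) x : ap_group g -> ap_norm (ap_act g x) = ap_norm x.
  by move=> gG; have [h [_ _ hq _] hE] := actI g gG; rewrite !qE hE hq.
have trans (x y : ap_module P) : maximal (e x) -> maximal (e y) -> ap_norm x = ap_norm y ->
    exists2 g : ap_elt P, ap_group g & ap_act g x = y.
  move=> mx my; rewrite !qE => xy; have [g gG gx] := red x mx.
  have [h hG hy] := red y my; have [h' h'G hK] := actV h hG.
  have [k kG kE] := actM h' g h'G gG; exists k; rewrite // kE -[y in RHS]hK.
  by congr ap_act; apply: (can_inj eK); rewrite gx hy xy.
have proj_act (g : ap_elt P) x : ap_group g -> ap_projective x -> ap_projective (ap_act g x).
  move=> gG /pE[k kI kX]; have [h hI hE] := actI g gG; apply/pE; rewrite hE.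
  have [h' h'I [hK _]] := Inv_inverse hI.
  by exists (fun X => k (h' X)); [exact: Inv_comp | rewrite hK].
have normal n : zero_or_one_mod4 n ->
    ap_projective (e' (normal_form C n)) /\ ap_norm (e' (normal_form C n)) = n.
  move=> n4; rewrite pE qE e'K quartic_normal_form //.
  by split=> //; apply: projective_normal_form.
have part2 n : zero_or_one_mod4 n ->
    acts_transitively (fun x : ap_module P => ap_projective x /\ ap_norm x = n).
  move=> n4; split=> [g x gG [xp xn]||x y [xp xn] [yp yn]].
  - by split; [exact: proj_act | rewrite norm_act].
  - by exists (e' (normal_form C n)); apply: normal.
  - by apply: trans; rewrite ?xn //; apply: projective_maximal; apply/pE.
split=> //; first by split=> // x; rewrite qE; apply: quartic_mod4.
move=> n nf; have np (x : ap_module P) : ap_norm x = n -> ap_projective x.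
  move=> xn; have mx : maximal (e x) by apply: fundamental_maximal; rewrite -qE xn.
  have [g gG gx] := red x mx; have [h hI hE] := actI g gG.
  apply/pE; have [k kI kX] := projective_normal_form C (quartic (e x)).
  by exists (fun X => k (h X)); [exact: Inv_comp | rewrite -hE gx].
split=> //; have n4 : zero_or_one_mod4 n.
  case: nf => [[_ n1] | [k [-> _ _]]]; first by right.
  by left; lia.
have [st _ tr] := part2 n n4; split=> [g x gG xn||x y xn yn].
- by rewrite norm_act.
- by exists (e' (normal_form C n)); have [] := normal n n4.
- by apply: tr; split=> //; apply: np.
Qed.

Lemma Inv_pair_classified C : split_composition C -> classified_by_norm (Inv_pair C).
Proof.
move=> splitC; have nM := split_normM splitC.
apply: (@normal_form_classifies (Inv_pair C) C id id) => //=.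
- by move=> g gI; exists g.
- by move=> g /Inv_inverse[h hI [gK _]]; exists h.
- by move=> g h gI hI; exists (fun X => g (h X)); first exact: Inv_comp.
apply: (reduce_to_normal_form (R := fun X Y => exists2 g, Inv g & g X = Y)) => //.
- by move=> X; exists id; first exact: Inv_id.
- move=> X Y Z [g gI <-] [h hI <-].
  by exists (fun X' => h (g X')); first exact: Inv_comp.
- by move=> t X; exists (translation t); first exact: translation_Inv.
- by move=> X; exists (@duality C); first exact: duality_Inv.
- by move=> X; exists (@rotation C); first exact: rotation_Inv.
- by move=> u X; exists (shear u); first exact: shear_Inv.
Qed.

(** * Generation of SL_n(Z) by transvections *)

Section Transvections.
Variable n : nat.
Implicit Types (i j k l : 'I_n) (t : int) (g : 'M[int]_n).

Definition transvection i j t : 'M[int]_n := 1%:M + t *: delta_mx i j.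

Lemma mul_transvection i j t g k l :
  (transvection i j t *m g) k l = g k l + t * (k == i)%:R * g j l.
Proof.
rewrite mulmxDl mul1mx !mxE; congr (_ + _); rewrite (bigD1 j) //= big1 => [|m /negPf mj].
  by rewrite !mxE eqxx andbT addr0.
by rewrite !mxE mj andbF mulr0 mul0r.
Qed.

Lemma mul_mx_transvection i j t g k l :
  (g *m transvection i j t) k l = g k l + g k i * t * (l == j)%:R.
Proof.
rewrite mulmxDr mulmx1 !mxE; congr (_ + _); rewrite (bigD1 i) //= big1 => [|m /negPf mi].
  by rewrite !mxE eqxx addr0 mulrA.
by rewrite !mxE mi mulr0 mulr0.
Qed.

Lemma mul_transvectionN i j t : i != j ->
  transvection i j (- t) *m transvection i j t = 1%:M.
Proof.
move=> /negPf ij; apply/matrixP => k l; rewrite mul_transvection !mxE.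
by rewrite [j == i]eq_sym ij [l == j]eq_sym; case: (k == i) => /=; ring.
Qed.

Lemma det_transvection i j t : i != j -> \det (transvection i j t) = 1.
Proof.
move=> ij; wlog lij : i j ij / (i < j)%N => [wl|].
  have [lij|lji|/val_inj ij0] := ltngtP i j; first exact: wl.
    rewrite -det_tr linearD /= tr_scalar_mx linearZ /= trmx_delta.
    by apply: wl => //; rewrite eq_sym.
  by rewrite ij0 eqxx in ij.
rewrite -det_tr det_trig.
  apply: big1 => k _; rewrite !mxE eqxx; case: eqP => [->|_]; rewrite ?mulr0 ?addr0 //.
  by rewrite (negPf ij) mulr0 addr0.
apply/is_trig_mxP => k l kl; rewrite !mxE -val_eqE gtn_eqF //=.
case: andP => [[/eqP li /eqP kj]|_]; last by rewrite mulr0 addr0.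
by move: kl; rewrite li kj ltnNge (ltnW lij).
Qed.

End Transvections.

(** Euclid's algorithm on the first column, then induction on the size. *)
Lemma SL_generated n (S : 'M[int]_n -> Prop) :
    S 1%:M -> (forall g h, S g -> S h -> S (g *m h)) ->
    (forall i j t, i != j -> S (transvection i j t)) ->
  forall g, \det g = 1 -> S g.
Proof.
elim: n S => [|n IH] S S1 SM St g dg; first by rewrite (flatmx0 g) -(flatmx0 1%:M).
pose R (g h : 'M[int]_n.+1) := (S h -> S g) /\ \det h = \det g.
have Rxx h : R h h by [].
have Rtrans h1 h2 h3 : R h1 h2 -> R h2 h3 -> R h1 h3.
  by move=> [S12 d12] [S23 d23]; split=> [/S23/S12|]; rewrite // d23.
have R_row i j t h : i != j -> R h (transvection i j t *m h).
  move=> ij; split; last by rewrite det_mulmx det_transvection // mul1r.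
  by move/(SM _ _ (St _ _ (- t) ij)); rewrite mulmxA mul_transvectionN // mul1mx.
pose pivot (h : 'M[int]_n.+1) := h ord0 ord0.
have [h Rgh mh] := exists_pivot_min pivot Rxx Rtrans g.
have dvd_col i : (h ord0 ord0 %| h i ord0)%Z.
  have [->|i0] := eqVneq i ord0; first exact: dvdzz.
  apply: (pivot_min_dvd (r := fun h' : 'M[int]_n.+1 => h' i ord0) Rtrans _ _ mh) => h' t.
    exists (transvection ord0 i t *m h'); first by apply: R_row; rewrite eq_sym.
    by rewrite /pivot mul_transvection eqxx mulr1.
  exists (transvection i ord0 t *m h'); first exact: R_row.
  rewrite /pivot !mul_transvection eqxx [ord0 == i]eq_sym (negPf i0).
  by rewrite mulr0 mul0r addr0 mulr1.
have dh : \det h = 1 by case: Rgh => _ ->.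
have pivot1 : h ord0 ord0 = 1 \/ h ord0 ord0 = -1.
  suff: (h ord0 ord0 %| \det h)%Z by rewrite dh dvdz1; lia.
  rewrite (expand_det_col _ ord0); apply: rpred_sum => i _.
  exact: dvdz_mulr.
have [k Rgk k1] : exists2 k, R g k & k ord0 ord0 = 1.
  case: pivot1 => [|hN1]; first by exists h.
  have [n0|n_gt0] := posnP n.
    by subst n; move: dh; rewrite det_mx11 -[0]/ord0 hN1.
  have mN0 : ord_max != ord0 :> 'I_n.+1 by rewrite -val_eqE /= -lt0n.
  (* The first step makes the entry below the pivot - 1 equal to 1; adding it
     twice to the pivot gives 1. *)
  pose h1 := transvection ord_max ord0 (h ord_max ord0 - 1) *m h.
  exists (transvection ord0 ord_max 2 *m h1).
    apply: (Rtrans _ _ _ Rgh); apply: (Rtrans _ _ _ (R_row _ _ _ _ mN0)).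
    by apply: R_row; rewrite eq_sym.
  rewrite !mul_transvection !eqxx hN1 [ord0 == _]eq_sym (negPf mN0) /=; ring.
have [k1' Rgk1 [k11 k1c]] : exists2 k1' : 'M[int]_n.+1, R g k1' & k1' ord0 ord0 = 1 /\
    forall i, i \in enum 'I_n.+1 -> i != ord0 -> k1' i ord0 = 0.
  elim: (enum 'I_n.+1) => [|i s [k' Rgk' [k'1 k'0]]]; first by exists k.
  have [i0|iN0] := eqVneq i ord0.
    exists k' => //; split=> // j; rewrite inE => /predU1P[->|]; last exact: k'0.
    by rewrite i0 eqxx.
  exists (transvection i ord0 (- k' i ord0) *m k').
    by apply: (Rtrans _ _ _ Rgk'); apply: R_row.
  split=> [|j]; rewrite mul_transvection k'1.
    by rewrite [ord0 == i]eq_sym (negPf iN0) mulr0 mul0r addr0.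
  rewrite inE; have [->|ji] := eqVneq j i; first by rewrite !mulr1 subrr.
  by move=> /= js jN0; rewrite k'0 // mulr0 mul0r addr0.
have R_col i j t h' : i != j -> R h' (h' *m transvection i j t).
  move=> ij; split; last by rewrite det_mulmx det_transvection // mulr1.
  have := mul_transvectionN (- t) ij; rewrite opprK => e.
  by move/SM/(_ (St _ _ (- t) ij)); rewrite -mulmxA e mulmx1.
have [k2 Rgk2 [k21 k2c k2r]] : exists2 k2 : 'M[int]_n.+1, R g k2 & [/\ k2 ord0 ord0 = 1,
    forall i, i != ord0 -> k2 i ord0 = 0 &
    forall j, j \in enum 'I_n.+1 -> j != ord0 -> k2 ord0 j = 0].
  have {}k1c i : i != ord0 -> k1' i ord0 = 0 by apply: k1c; rewrite mem_enum.
  elim: (enum 'I_n.+1) => [|j s [k' Rgk' [k'1 k'c k'0]]]; first by exists k1'.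
  have [j0|jN0] := eqVneq j ord0.
    exists k' => //; split=> // l; rewrite inE => /predU1P[->|]; last exact: k'0.
    by rewrite j0 eqxx.
  exists (k' *m transvection ord0 j (- k' ord0 j)).
    by apply: (Rtrans _ _ _ Rgk'); apply: R_col; rewrite eq_sym.
  split=> [|i iN0|l]; rewrite mul_mx_transvection ?k'1.
  - by rewrite [ord0 == j]eq_sym (negPf jN0) mulr0 addr0.
  - by rewrite k'c // !mul0r addr0.
  rewrite inE; have [->|lj] := eqVneq l j; first by rewrite mul1r mulr1 subrr.
  by move=> /= ls lN0; rewrite k'0 // mulr0 addr0.
have lN0 (i : 'I_n) : rshift 1 i != ord0 :> 'I_(1 + n) by [].
have l0 (i : 'I_1) : lshift n i = ord0 :> 'I_(1 + n).
  by apply: val_inj; rewrite /= ord1.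
pose K : 'M[int]_(1 + n) := k2.
have KE : K = block_mx 1%:M 0 0 (drsubmx K).
  have e1 : ulsubmx K = 1%:M.
    by apply/matrixP => i j; rewrite !mxE !l0 /K k21 !ord1.
  have e2 : ursubmx K = 0.
    by apply/matrixP => i j; rewrite !mxE l0 /K k2r ?mem_enum.
  have e3 : dlsubmx K = 0.
    by apply/matrixP => i j; rewrite !mxE l0 /K k2c.
  by rewrite -{1}[K]submxK e1 e2 e3.
case: Rgk2 => Sk2; rewrite dg => dk2; apply: Sk2; rewrite -[k2]/K KE.
apply: (IH (fun h' => S (block_mx (1%:M : 'M_1) 0 0 h'))) => [|g1 g2 Sg1 Sg2|i j t ij|].
- by rewrite -scalar_mx_block.
- have := SM _ _ Sg1 Sg2.
  by rewrite (@mulmx_block _ 1 n 1 n 1 n) !(mulmx0, mul0mx, mulmx1, mul1mx) ?addr0 ?add0r.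
- have /(St _ _ t) : rshift 1 i != rshift 1 j :> 'I_(1 + n).
    by rewrite (inj_eq (@rshift_inj _ _)).
  suff -> : transvection (rshift 1 i) (rshift 1 j) t
      = block_mx 1%:M 0 0 (transvection i j t) :> 'M_(1 + n) by [].
  apply/matrixP => p q; rewrite !mxE.
  case: splitP => p' pE; rewrite !mxE; case: splitP => q' qE; rewrite !mxE -!val_eqE /= pE qE.
  - by rewrite !ord1 !add1n /= mulr0 addr0.
  - by rewrite !ord1 !add1n /= mulr0 addr0.
  - by rewrite !ord1 !add1n /= andbF mulr0 addr0.
  - by rewrite !add1n !eqSS.
- by rewrite -dk2 -[k2]/K {2}KE (@det_lblock _ 1 n) det1 mul1r.
Qed.

(** * The moves on the exterior cube *)

Section ExteriorAction.
Local Notation F := freudenthal_ext3.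
Local Notation vec := 'cV[int]_6.
Implicit Types (g h : 'M[int]_6) (x : ext3) (X : freudenthal bin_ring).

Lemma ext3_actE g x :
  ext3_act g x = \sum_(t : triple) wedge (g *m basis_vec (val t).1.1)
    (g *m basis_vec (val t).1.2) (g *m basis_vec (val t).2) *~ x t.
Proof. by apply: eq_bigr => t _; case: (val t) => -[i j] k. Qed.

Lemma ext3_actD g : {morph ext3_act g : x y / x + y}.
Proof.
move=> x y; rewrite !ext3_actE -big_split; apply: eq_bigr => t _.
by rewrite ext3_addE mulrzDr.
Qed.

Lemma ext3_actz g x k : ext3_act g (x *~ k) = ext3_act g x *~ k.
Proof. by rewrite (additive_mulrz (ext3_actD g)). Qed.

Lemma ext3_act0 g : ext3_act g 0 = 0.
Proof. by rewrite ext3_actE big1 // => t _; rewrite ffunE mulr0z. Qed.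

Lemma ext3_act_sum g (I : finType) (G : I -> ext3) :
  ext3_act g (\sum_i G i) = \sum_i ext3_act g (G i).
Proof. by apply: (big_morph _ (ext3_actD g) (ext3_act0 g)). Qed.

Lemma ext3_actM g h x : ext3_act (g *m h) x = ext3_act g (ext3_act h x).
Proof.
rewrite (ext3_actE h) ext3_act_sum ext3_actE; apply: eq_bigr => t _.
by rewrite ext3_actz ext3_act_wedge !mulmxA.
Qed.

(** The image of the Freudenthal element X when the standard basis is replaced by
    six arbitrary vectors. *)
Definition frame_elt (e f : 'I_3 -> vec) X : ext3 :=
  let: (alpha, beta, A, B) := X in
  wedge (e 0) (e 1) (e 2) *~ alpha + wedge (f 0) (f 1) (f 2) *~ beta
  + \sum_i \sum_j wedge (e i) (f (ordS j)) (f (ord_pred j)) *~ bin_cubic_mx A i j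
  + \sum_i \sum_j wedge (f i) (e (ordS j)) (e (ord_pred j)) *~ bin_cubic_mx B i j.

Lemma frame_eltE X : F X = frame_elt e_ f_ X. Proof. by []. Qed.

Lemma ext3_act_frame g e f X :
  ext3_act g (frame_elt e f X) =
  frame_elt (fun i => g *m e i) (fun i => g *m f i) X.
Proof.
case: X => [[[al be] A] B]; rewrite /frame_elt !ext3_actD !ext3_actz !ext3_act_wedge.
by congr (_ + _ + _); rewrite ext3_act_sum; apply: eq_bigr => i _;
   rewrite ext3_act_sum; apply: eq_bigr => j _; rewrite ext3_actz ext3_act_wedge.
Qed.

Lemma sum3 (V : zmodType) (G : 'I_3 -> V) : \sum_i G i = G 0 + G 1 + G 2.
Proof.
rewrite !big_ord_recl big_ord0 addr0 addrA.
by congr (_ + G _ + G _); apply: val_inj.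
Qed.

Lemma ord3P (k : 'I_3) : [\/ k = 0, k = 1 | k = 2].
Proof.
by case: k => [[|[|[|//]]] p]; [constructor 1 | constructor 2 | constructor 3];
   apply: val_inj.
Qed.

Lemma mx_mulrz (v : vec) (k : int) i j : (v *~ k) i j = v i j * k.
Proof.
by rewrite (additive_mulrz (f := fun M : vec => M i j)) ?mulrzz // => M N; rewrite mxE.
Qed.

Definition minor3 (t : triple) (u v w : vec) : int :=
  let: (i, j, k) := val t in
  u i 0 * (v j 0 * w k 0 - w j 0 * v k 0)
  - v i 0 * (u j 0 * w k 0 - w j 0 * u k 0)
  + w i 0 * (u j 0 * v k 0 - v j 0 * u k 0).

Lemma frame_coord t (e f : 'I_3 -> vec) al be a b c (x y z : int * int)
    a' b' c' (x' y' z' : int * int) :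
  frame_elt e f (al, be, ((a, b, c), (x, y, z)), ((a', b', c'), (x', y', z'))) t =
  let D := minor3 t in
  D (e 0) (e 1) (e 2) * al + D (f 0) (f 1) (f 2) * be
  + (D (e 0) (f 1) (f 2) * a + D (e 0) (f 2) (f 0) * z.1 + D (e 0) (f 0) (f 1) * y.2
   + D (e 1) (f 1) (f 2) * z.2 + D (e 1) (f 2) (f 0) * b + D (e 1) (f 0) (f 1) * x.1
   + D (e 2) (f 1) (f 2) * y.1 + D (e 2) (f 2) (f 0) * x.2 + D (e 2) (f 0) (f 1) * c)
  + (D (f 0) (e 1) (e 2) * a' + D (f 0) (e 2) (e 0) * z'.1 + D (f 0) (e 0) (e 1) * y'.2
   + D (f 1) (e 1) (e 2) * z'.2 + D (f 1) (e 2) (e 0) * b' + D (f 1) (e 0) (e 1) * x'.1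
   + D (f 2) (e 1) (e 2) * y'.1 + D (f 2) (e 2) (e 0) * x'.2 + D (f 2) (e 0) (e 1) * c').
Proof.
have cyc_sum (v w : 'I_3 -> vec) (M : 'M[int]_3) :
    (\sum_i \sum_j wedge (v i) (w (ordS j)) (w (ord_pred j)) *~ M i j) t =
    minor3 t (v 0) (w 1) (w 2) * M 0 0 + minor3 t (v 0) (w 2) (w 0) * M 0 1
    + minor3 t (v 0) (w 0) (w 1) * M 0 2
    + (minor3 t (v 1) (w 1) (w 2) * M 1 0 + minor3 t (v 1) (w 2) (w 0) * M 1 1
       + minor3 t (v 1) (w 0) (w 1) * M 1 2)
    + (minor3 t (v 2) (w 1) (w 2) * M 2 0 + minor3 t (v 2) (w 2) (w 0) * M 2 1
       + minor3 t (v 2) (w 0) (w 1) * M 2 2).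
  have step i : (\sum_j wedge (v i) (w (ordS j)) (w (ord_pred j)) *~ M i j) t =
      minor3 t (v i) (w 1) (w 2) * M i 0 + minor3 t (v i) (w 2) (w 0) * M i 1
      + minor3 t (v i) (w 0) (w 1) * M i 2.
    rewrite sum_ffunE sum3 !ext3_mulrz !wedgeE.
    congr (_ + _ + _); congr (_ * _); congr (minor3 _ _ (w _) (w _)); exact: val_inj.
  by rewrite sum_ffunE sum3 !step.
rewrite /frame_elt !ext3_addE !ext3_mulrz !cyc_sum !wedgeE -!/(minor3 t _ _ _).
rewrite !mxE /= !pair_mulrz /= !mulrzz /= !mul1r; ring.
Qed.

Ltac frame_identity :=
  case=> [[[? ?] [[[? ?] ?] [[[? ?] [? ?]] [? ?]]]] [[[? ?] ?] [[[? ?] [? ?]] [? ?]]]];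
  apply/ffunP => -[[[? ?] ?] ?]; rewrite ?cubicN [RHS]frame_coord [LHS]frame_coord;
  rewrite /= ?pair_mulrz /= ?mulrzz /minor3 /= !mxE ?mx_mulrz; ring.

(** Each generator of the reduction is a change of frame. The identities hold for
    arbitrary frames, coordinate by coordinate, as polynomial identities. *)
Lemma frame_translation t (e f : 'I_3 -> vec) X :
  frame_elt e (fun i => if i == 0 then f i + e 0 *~ t else f i) X
  = frame_elt e f (translation t X).
Proof. move: X; rewrite /translation; frame_identity. Qed.

Lemma frame_duality (e f : 'I_3 -> vec) X :
  frame_elt f (fun i => - e i) X = frame_elt e f (duality X).
Proof. move: X; rewrite /duality; frame_identity. Qed.

Lemma frame_rotation (e f : 'I_3 -> vec) X :
  frame_elt (fun i => e (ord_pred i)) (fun i => f (ord_pred i)) X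
  = frame_elt e f (rotation X).
Proof.
have P0 : ord_pred (0 : 'I_3) = 2 by apply: val_inj.
have P1 : ord_pred (1 : 'I_3) = 0 by apply: val_inj.
have P2 : ord_pred (2 : 'I_3) = 1 by apply: val_inj.
move: X => [[[al be] [[[a b] c] [[[x1 x2] [y1 y2]] [z1 z2]]]]].
move=> [[[a' b'] c'] [[[x1' x2'] [y1' y2']] [z1' z2']]].
apply/ffunP => s; rewrite [RHS]frame_coord [LHS]frame_coord.
rewrite (congr1 e P0) (congr1 f P0) (congr1 e P1) (congr1 f P1) (congr1 e P2) (congr1 f P2).
rewrite /= /minor3; case: (val s) => -[i j] k; ring.
Qed.

Lemma frame_shear u (e f : 'I_3 -> vec) X :
  frame_elt (fun i => if i == 1 then e i + e 0 *~ u.1 else e i)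
    (fun i => if i == 0 then f i + f 1 *~ (- u.2) else f i) X
  = frame_elt e f (shear (u : bin_ring) X).
Proof.
case: u => u1 u2; move: X; rewrite /shear /upper_shear /lower_shear /norm2.
frame_identity.
Qed.

Lemma frame_ext (e e' f f' : 'I_3 -> vec) X :
  e =1 e' -> f =1 f' -> frame_elt e f X = frame_elt e' f' X.
Proof.
move=> ee ff; case: X => [[[al be] A] B]; rewrite /frame_elt !ee !ff.
congr (_ + _ + _); apply: eq_bigr => i _; apply: eq_bigr => j _.
  by rewrite (ee i) (ff (ordS j)) (ff (ord_pred j)).
by rewrite (ff i) (ee (ordS j)) (ee (ord_pred j)).
Qed.

Definition realizes g (m : freudenthal bin_ring -> freudenthal bin_ring) :=
  forall X, ext3_act g (F X) = F (m X).

Lemma realizes_frame g (e f : 'I_3 -> vec) m :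
    (forall i, g *m e_ i = e i) -> (forall i, g *m f_ i = f i) ->
    (forall X, frame_elt e f X = frame_elt e_ f_ (m X)) -> realizes g m.
Proof.
move=> ge gf mE X; rewrite !frame_eltE ext3_act_frame -mE.
exact: frame_ext.
Qed.

Lemma realizes_comp g h m m' :
  realizes g m -> realizes h m' -> realizes (g *m h) (fun X => m (m' X)).
Proof. by move=> gm hm X; rewrite ext3_actM hm gm. Qed.

Lemma realizes1 : realizes 1%:M id.
Proof. by apply: (@realizes_frame _ e_ f_) => // i; rewrite mul1mx. Qed.

Lemma scale_mulrz m n (k : int) (A : 'M[int]_(m, n)) : k *: A = A *~ k.
Proof. by rewrite -scaler_int intz. Qed.

Lemma transvection_basis i j t l :
  transvection i j t *m basis_vec l =
  if l == j then basis_vec l + basis_vec i *~ t else basis_vec l.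
Proof.
rewrite mulmxDl mul1mx -scalemxAl mul_delta_mx_cond.
case: (eqVneq l j) => [->|lj]; first by rewrite mulr1n scale_mulrz.
by rewrite mulr0n scaler0 addr0.
Qed.

Lemma mx_basis_ext g h : (forall l, g *m basis_vec l = h *m basis_vec l) -> g = h.
Proof.
move=> gh; apply/matrixP => i j; have := congr1 (fun v : vec => v i 0) (gh j).
by rewrite /basis_vec -!colE !mxE.
Qed.

(** Here g is a signed permutation matrix and h its inverse. *)
Lemma conj_transvection g h (s : 'I_6 -> 'I_6) (c : 'I_6 -> int) i j t :
    injective s -> (forall l, g *m basis_vec l = basis_vec (s l) *~ c l) ->
    (forall l, c l * c l = 1) -> g *m h = 1%:M ->
  g *m transvection i j t *m h = transvection (s i) (s j) (c j * c i * t).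
Proof.
move=> sI gs c1 gh.
suff -> : g *m transvection i j t = transvection (s i) (s j) (c j * c i * t) *m g.
  by rewrite -mulmxA gh mulmx1.
apply: mx_basis_ext => l; rewrite -!mulmxA gs transvection_basis.
have mulz (M : 'M[int]_6) (v : vec) k : M *m (v *~ k) = (M *m v) *~ k.
  by rewrite -!scale_mulrz -scalemxAr.
rewrite mulz transvection_basis (inj_eq sI); case: eqP => [-> | _]; last by rewrite gs.
rewrite mulmxDr mulz !gs mulrzDl -!mulrzA; congr (_ + _ *~ _).
by transitivity (c j * c j * c i * t); [rewrite c1 mul1r | ring].
Qed.

End ExteriorAction.

(** * The action of SL6 *)

Lemma commutator_transvection n (i j k : 'I_n) t : i != j -> j != k -> i != k ->
  transvection i j t *m transvection j k 1 *m transvection i j (- t)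
    *m transvection j k (-1) = transvection i k t.
Proof.
move=> /negPf ij /negPf jk /negPf ik.
have [ji kj ki] : [/\ (j == i) = false, (k == j) = false & (k == i) = false].
  by rewrite ![_ == j]eq_sym ![_ == i]eq_sym.
apply/matrixP => p q; rewrite -!mulmxA !mul_transvection !mxE !eqxx ?ij ?jk ?ik ?ji ?kj ?ki.
rewrite ![k == q]eq_sym.
by case: (p == i); case: (p == j); case: (q == k) => /=; ring.
Qed.

Section SpecialLinear6.
Local Open Scope comp_scope.
Local Notation F := freudenthal_ext3.
Implicit Types (g h : 'M[int]_6).

Definition acts_in_Inv g := exists2 m, Inv m & realizes g m.

Lemma acts_in_Inv_mul g h : acts_in_Inv g -> acts_in_Inv h -> acts_in_Inv (g *m h).
Proof.
move=> [m mI gm] [m' m'I hm']; exists (fun X => m (m' X)); first exact: Inv_comp.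
exact: realizes_comp.
Qed.

Lemma acts_in_Inv1 : acts_in_Inv 1%:M.
Proof. exists id; [exact: Inv_id | exact: realizes1]. Qed.

Lemma acts_in_Inv_inv g h : h *m g = 1%:M -> acts_in_Inv g -> acts_in_Inv h.
Proof.
move=> hg [m /Inv_inverse[m' m'I [mK m'K]] gm]; exists m' => // X.
by rewrite -{1}(m'K X) -gm -ext3_actM hg realizes1.
Qed.

Let normM : forall x y : bin_ring, cr_norm (x ∘ y) = cr_norm x * cr_norm y :=
  split_normM bin_split.

Let l (i : 'I_3) : 'I_6 := lshift 3 i.
Let r (i : 'I_3) : 'I_6 := rshift 3 i.

Let lr i j : (l i == r j) = false.
Proof. exact: eq_lrshift. Qed.
Let rl i j : (r i == l j) = false.
Proof. by rewrite eq_sym lr. Qed.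
Let ll i j : (l i == l j) = (i == j).
Proof. exact: eq_lshift. Qed.
Let rr i j : (r i == r j) = (i == j).
Proof. exact: (inj_eq (@rshift_inj 3 3)). Qed.

Let transvection_e i j t k : transvection i j t *m e_ k =
  if l k == j then e_ k + basis_vec i *~ t else e_ k.
Proof. exact: transvection_basis. Qed.

Let transvection_f i j t k : transvection i j t *m f_ k =
  if r k == j then f_ k + basis_vec i *~ t else f_ k.
Proof. exact: transvection_basis. Qed.

Lemma translation_realized t : realizes (transvection (l 0) (r 0) t) (translation t).
Proof.
apply: (realizes_frame _ _ (frame_translation t e_ f_)) => k.
  by rewrite transvection_e lr.
by rewrite transvection_f rr.
Qed.

Lemma shear_realized (u : bin_ring) :
  realizes (transvection (l 0) (l 1) u.1 *m transvection (r 1) (r 0) (- u.2)) (shear u).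
Proof.
apply: (realizes_frame _ _ (frame_shear u e_ f_)) => k; rewrite -mulmxA.
  by rewrite transvection_e lr transvection_e ll.
rewrite transvection_f rr; case: eqP => _; last by rewrite transvection_f rl.
by rewrite mulmxDr -scale_mulrz -scalemxAr !transvection_f !rl scale_mulrz.
Qed.

Definition dual_mx : 'M[int]_6 := block_mx 0 (- 1%:M) 1%:M 0 : 'M_(3 + 3).

Definition rot_mx3 : 'M[int]_3 := \matrix_(i, j) (i == ord_pred j)%:R.

Definition rot_mx : 'M[int]_6 := block_mx rot_mx3 0 0 rot_mx3 : 'M_(3 + 3).

Let eE i : e_ i = col_mx (delta_mx i 0) 0 :> 'cV_(3 + 3).
Proof. exact: delta_mx_ushift. Qed.
Let fE i : f_ i = col_mx 0 (delta_mx i 0) :> 'cV_(3 + 3).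
Proof. exact: delta_mx_dshift. Qed.

Let block_mul_col (P Q R S : 'M[int]_3) (v w : 'cV[int]_3) :
  (block_mx P Q R S : 'M_6) *m (col_mx v w : 'cV_6)
  = col_mx (P *m v + Q *m w) (R *m v + S *m w).
Proof. exact: (@mul_block_col _ 3 3 3 3 1). Qed.

Lemma dual_mx_e i : dual_mx *m e_ i = f_ i.
Proof. by rewrite eE fE (block_mul_col _ _ _ _ _ _) !(mulmx0, mul0mx, mul1mx, addr0). Qed.

Lemma dual_mx_f i : dual_mx *m f_ i = - e_ i.
Proof.
rewrite eE fE (block_mul_col _ _ _ _ _ _) !(mulmx0, mul0mx, mul1mx, add0r, addr0, mulNmx).
by have := opp_col_mx (delta_mx i 0 : 'cV[int]_3) (0 : 'cV[int]_3); rewrite oppr0 => ->.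
Qed.

Lemma rot_mx3_delta i : rot_mx3 *m delta_mx i (0 : 'I_1) = delta_mx (ord_pred i) 0.
Proof. by rewrite -colE; apply/matrixP => p q; rewrite !mxE !ord1 andbT. Qed.

Lemma rot_mx_e i : rot_mx *m e_ i = e_ (ord_pred i).
Proof. by rewrite !eE (block_mul_col _ _ _ _ _ _) !(mulmx0, mul0mx, addr0) rot_mx3_delta. Qed.

Lemma rot_mx_f i : rot_mx *m f_ i = f_ (ord_pred i).
Proof.
by rewrite !fE (block_mul_col _ _ _ _ _ _) !(mulmx0, mul0mx, add0r, addr0) rot_mx3_delta.
Qed.

Lemma det_rot_mx : \det rot_mx = 1.
Proof.
have -> : \det rot_mx = \det rot_mx3 * \det rot_mx3.
  exact: (@det_ublock _ 3 3).
by rewrite mx3_detE !mxE.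
Qed.

Lemma det_dual_mx : \det dual_mx = 1.
Proof.
pose U : 'M[int]_(3 + 3) := block_mx 1%:M (- 1%:M) 0 1%:M.
pose L : 'M[int]_(3 + 3) := block_mx 1%:M 0 1%:M 1%:M.
have dualE : dual_mx = U *m L *m U :> 'M_(3 + 3).
  rewrite /U /L !mulmx_block !(mulmx0, mul0mx, mulmx1, mul1mx, addr0, add0r).
  by rewrite !(subrr, addNr, mul0mx, add0r, addr0).
have : \det (U *m L *m U) = 1.
  by rewrite !det_mulmx /U /L det_ublock det_lblock !det1 !mul1r.
by rewrite -dualE.
Qed.

Lemma duality_realized : realizes dual_mx (@duality bin_ring).
Proof.
apply: (realizes_frame _ _ (frame_duality e_ f_)) => k; first exact: dual_mx_e.
exact: dual_mx_f.
Qed.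

Lemma rotation_realized : realizes rot_mx (@rotation bin_ring).
Proof.
apply: (realizes_frame _ _ (frame_rotation e_ f_)) => k; first exact: rot_mx_e.
exact: rot_mx_f.
Qed.

Let transv i j := forall t, acts_in_Inv (transvection i j t).

Let SL_unit g : \det g = 1 -> g *m invmx g = 1%:M /\ invmx g *m g = 1%:M.
Proof. by move=> dg; rewrite mulmxV ?mulVmx // unitmxE dg unitr1. Qed.

Let transv_conj g (s : 'I_6 -> 'I_6) (c : 'I_6 -> int) i j :
    \det g = 1 -> acts_in_Inv g -> injective s ->
    (forall k, g *m basis_vec k = basis_vec (s k) *~ c k) ->
    (forall k, c k * c k = 1) -> transv i j -> transv (s i) (s j).
Proof.
move=> /SL_unit[gV Vg] ag sI gs c1 ij t.
have -> : t = c j * c i * (c j * c i * t).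
  by transitivity ((c j * c j) * (c i * c i) * t); [rewrite !c1 !mul1r | ring].
rewrite -(conj_transvection _ _ _ sI gs c1 gV).
apply: acts_in_Inv_mul; first by apply: acts_in_Inv_mul.
exact: acts_in_Inv_inv ag.
Qed.

(** Functions of an index of 'I_6 given separately on the e's and on the f's. *)
Let half (A : Type) (a b : 'I_3 -> A) (k : 'I_6) : A :=
  match split (k : 'I_(3 + 3)) with inl i => a i | inr i => b i end.

Let half_l A (a b : 'I_3 -> A) i : half a b (l i) = a i.
Proof. by rewrite /half (unsplitK (inl i : 'I_3 + 'I_3)). Qed.

Let half_r A (a b : 'I_3 -> A) i : half a b (r i) = b i.
Proof. by rewrite /half (unsplitK (inr i : 'I_3 + 'I_3)). Qed.

Let halfP (k : 'I_6) : (exists i, k = l i) \/ (exists i, k = r i).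
Proof.
by have := splitK (k : 'I_(3 + 3)); case: (split _) => i <-; [left | right]; exists i.
Qed.

Let acts_dual : acts_in_Inv dual_mx.
Proof. by exists (@duality _); [exact: duality_Inv | exact: duality_realized]. Qed.

Let acts_rot : acts_in_Inv rot_mx.
Proof. by exists (@rotation _); [exact: rotation_Inv | exact: rotation_realized]. Qed.

Let transv_dual i j : transv i j -> transv (half r l i) (half r l j).
Proof.
apply: (@transv_conj dual_mx _ (half (fun=> 1) (fun=> -1))).
- exact: det_dual_mx.
- exact: acts_dual.
- apply: (can_inj (g := half r l)) => k.
  by case: (halfP k) => -[k' ->]; rewrite !(half_l, half_r).
- move=> k; case: (halfP k) => -[k' ->]; rewrite !(half_l, half_r) ?mulrN1z.
    by rewrite [LHS]dual_mx_e.
  by rewrite [LHS]dual_mx_f.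
- by move=> k; case: (halfP k) => -[k' ->]; rewrite !(half_l, half_r).
Qed.

Let pred6 := half (fun i => l (ord_pred i)) (fun i => r (ord_pred i)).

Let transv_rot i j : transv i j -> transv (pred6 i) (pred6 j).
Proof.
apply: (@transv_conj rot_mx _ (fun=> 1)).
- exact: det_rot_mx.
- exact: acts_rot.
- apply: (can_inj (g := half (fun i => l (ordS i)) (fun i => r (ordS i)))) => k.
  by rewrite /pred6; case: (halfP k) => -[k' ->]; rewrite !(half_l, half_r) ord_predK.
- move=> k; rewrite /pred6; case: (halfP k) => -[k' ->]; rewrite !(half_l, half_r).
    by rewrite [LHS]rot_mx_e.
  by rewrite [LHS]rot_mx_f.
- by [].
Qed.

Let orbit3 (Q : 'I_3 -> Prop) : Q 0 -> (forall i, Q i -> Q (ord_pred i)) -> forall i, Q i.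
Proof.
move=> Q0 Qp i; have Q2 := Qp _ Q0; have Q1 := Qp _ Q2.
case: (ord3P i) => -> //.
  by move: Q1; congr Q; apply: val_inj.
by move: Q2; congr Q; apply: val_inj.
Qed.

Let ord3_next (i j : 'I_3) : i != j -> j = ordS i \/ i = ordS j.
Proof.
case: (ord3P i) => ->; case: (ord3P j) => -> // _;
  by [left; apply: val_inj | right; apply: val_inj].
Qed.

Let transvection0 i j : transvection i j 0 = 1%:M :> 'M[int]_6.
Proof. by rewrite /transvection scale0r addr0. Qed.

(** Shears give the transvections between consecutive e's; rotating and dualizing
    them gives the others. *)
Let transv_ll i j : i != j -> transv (l i) (l j).
Proof.
have acts_shear (u : bin_ring) : acts_in_Inv
    (transvection (l 0) (l 1) u.1 *m transvection (r 1) (r 0) (- u.2)).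
  by exists (shear u); [exact: shear_Inv | exact: shear_realized].
have S0 : ordS (0 : 'I_3) = 1 by apply: val_inj.
have up : forall i, transv (l i) (l (ordS i)).
  apply: orbit3 => [|k /transv_rot]; last by rewrite /pred6 !half_l ordSK ord_predK.
  move=> t; have := acts_shear (t, 0).
  by rewrite /= oppr0 transvection0 mulmx1 S0.
have dn : forall i, transv (l (ordS i)) (l i).
  apply: orbit3 => [|k /transv_rot]; last by rewrite /pred6 !half_l ordSK ord_predK.
  have /transv_dual : transv (r 1) (r 0).
    by move=> t; have := acts_shear (0, - t); rewrite /= transvection0 mul1mx opprK.
  by rewrite !half_r S0.
by case/ord3_next => ->.
Qed.

(** The translations give the pairs (e_i, f_i), commutators the others. *)
Let transv_lr i j : transv (l i) (r j).
Proof.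
have diag : forall i, transv (l i) (r i).
  apply: orbit3 => [t|k /transv_rot]; last by rewrite /pred6 half_l half_r.
  by exists (translation t); [exact: translation_Inv | exact: translation_realized].
have [->|ij] := eqVneq i j; first exact: diag.
have [d1 d2 d3] : [/\ l i != l j, l j != r j & l i != r j] by rewrite ll ij !lr.
move=> t; rewrite -(commutator_transvection t d1 d2 d3).
exact: (acts_in_Inv_mul (acts_in_Inv_mul (acts_in_Inv_mul (transv_ll ij t) (diag j 1))
  (transv_ll ij (- t))) (diag j (-1))).
Qed.

Lemma SL6_acts_in_Inv g : \det g = 1 -> acts_in_Inv g.
Proof.
apply: SL_generated; first exact: acts_in_Inv1.
  by move=> g1 g2; apply: acts_in_Inv_mul.
move=> i j t; case: (halfP i) => -[i' ->]; case: (halfP j) => -[j' ->] ij.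
- by apply: transv_ll; rewrite -ll.
- exact: transv_lr.
- by have /transv_dual := transv_lr i' j'; rewrite half_l half_r; apply.
- have /transv_ll/transv_dual : i' != j' by rewrite -rr.
  by rewrite !half_l; apply.
Qed.

Lemma SL6_pair_classified : classified_by_norm SL6_pair.
Proof.
apply: (@normal_form_classifies SL6_pair bin_ring ext3_freudenthal F ext3_freudenthalK
  freudenthal_ext3K) => //=.
- move=> g /SL6_acts_in_Inv[m mI gm]; exists m => // x.
  by rewrite -{1}(ext3_freudenthalK x) gm freudenthal_ext3K.
- move=> g dg; have [gV Vg] := SL_unit dg; exists (invmx g).
    by have := congr1 determinant Vg; rewrite det_mulmx dg det1 mulr1.
  by move=> x; rewrite -ext3_actM Vg -(ext3_freudenthalK x) realizes1.
- move=> g h dg dh; exists (g *m h); first by rewrite det_mulmx dg dh.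
  by move=> x; rewrite ext3_actM.
pose R (X Y : freudenthal bin_ring) :=
  exists2 g : 'M[int]_6, \det g = 1 & ext3_act g (F X) = F Y.
have R_realized g m X : \det g = 1 -> realizes g m -> R X (m X) by exists g.
suff red X : maximal X -> R X (normal_form bin_ring (quartic X)).
  move=> x /red[g dg gx]; exists g; first exact: dg.
  by rewrite -{1}(ext3_freudenthalK x) gx freudenthal_ext3K.
apply: reduce_to_normal_form => [|Y|Y1 Y2 Y3|t Y|Y|Y|u Y|Y1 Y2].
- exact: bin_split.
- by apply: (R_realized 1%:M id); [rewrite det1 | exact: realizes1].
- move=> [g dg gY] [h dh hY]; exists (h *m g); first by rewrite det_mulmx dg dh.
  by rewrite ext3_actM gY.
- by apply: R_realized (translation_realized t); rewrite det_transvection.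
- exact: R_realized det_dual_mx duality_realized.
- exact: R_realized det_rot_mx rotation_realized.
- by apply: R_realized (shear_realized u); rewrite det_mulmx !det_transvection.
- move=> [g /SL6_acts_in_Inv[m mI gm] gY]; exists m => //.
  by rewrite -[LHS]freudenthal_ext3K -gm gY freudenthal_ext3K.
Qed.

End SpecialLinear6.

Theorem theorem47 (P : action_pair)
    (hP : [\/ P = SL6_pair, P = D6_pair | P = E7_pair]) :
  [/\ (forall g (x : ap_module P),
         ap_group g -> ap_norm (ap_act g x) = ap_norm x) /\
      (forall x : ap_module P, zero_or_one_mod4 (ap_norm x)),
      forall n : int, zero_or_one_mod4 n ->
        acts_transitively (fun x : ap_module P => ap_projective x /\ ap_norm x = n)
    & forall n : int, fundamental_discriminant n ->
        (forall x : ap_module P, ap_norm x = n -> ap_projective x) /\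
        acts_transitively (fun x : ap_module P => ap_norm x = n)].
Proof.
rewrite -/(classified_by_norm P); case: hP => ->.
- exact: SL6_pair_classified.
- exact: Inv_pair_classified quat_split.
- exact: Inv_pair_classified oct_split.
Qed.
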